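(* Any Riemannian manifold $X$ satisfying the viscosity, strong Laplacian principle must be (geodesically) complete.
   Context: **Jets.** $X$ is a smooth Riemannian manifold, possibly incomplete. $J^2(X)\to X$ is the 2-jet bundle, split via the Levi-Civita connection as $J^2(X)=\mathbf R\oplus T^*X\oplus \mathrm{Sym}^2(T^*X)$; its points are written $(x,r,p,A)$, and $J^2_xu=(x,u(x),du(x),\nabla^2u(x))$ if $u$ is $C^2$ near $x$. For $F\subset J^2(X)$, $F_x$ is the fiber over $x$; a set such as $\{|p|\ge 1\}$ means the set of all $(x,r,p,A)\in J^2(X)$ satisfying the condition. $\mathrm{USC}(Y)$ denotes upper semicontinuous functions $Y\to[-\infty,+\infty)$. A test for $u$ at $x$ is a function $\phi$, $C^2$ near $x$, with $\phi\ge u$ near $x$ and $\phi(x)=u(x)$. For $\Omega\subset X$ open, $u\in F(\Omega)$ if $u\in\mathrm{USC}(\Omega)$ and $J^2_x\phi\in F_x$ for all $x\in\Omega$ and all tests $\phi$ for $u$ at $x$; for $K\subset X$ closed, $u\in F(K)$ means $u\in\mathrm{USC}(K)$ and $u\in F(\mathrm{Int}\,K)$. **Ahlfors property** of $G\subset J^2(X)$: setting $H=G\cup\{r\le0\}$, for each open $U\subset X$ with non-empty boundary and each $u\in H(\overline U)$ bounded from above and positive somewhere, $\sup_{\partial U}u^+=\sup_{\overline U}u$, where $u^+=\max\{u,0\}$. **Viscosity, strong Laplacian principle** on $X$: the Ahlfors property holds for $\widetilde F\cup\widetilde E$, where $\widetilde F=\{\mathrm{Tr}(A)\ge1\}$ and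 $\widetilde E=\{|p|\ge1\}$. *)

(* Defs.v *)
From HB Require Import structures.
From mathcomp Require Import all_boot all_order all_algebra.
From mathcomp Require Import all_classical all_reals all_analysis.

Set Implicit Arguments.
Unset Strict Implicit.
Unset Printing Implicit Defensive.
Import Order.TTheory GRing.Theory Num.Theory.
Import numFieldNormedType.Exports.

Local Open Scope classical_set_scope.
Local Open Scope ring_scope.

Section Calculus.
Context {R : realType} {n : nat}.
Implicit Types (U : set 'rV[R]_n) (f : 'rV[R]_n -> R).

Definition pd (a : 'I_n) f : 'rV[R]_n -> R := fun y => 'D_(delta_mx 0 a) f y.

(* meant for open [U] *)
Fixpoint Ck_on (k : nat) U f : Prop :=
  (forall y, U y -> {for y, continuous f}) /\
  (if k is k'.+1 then
     forall a : 'I_n, (forall y, U y -> derivable f y (delta_mx 0 a)) /\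
                      Ck_on k' U (pd a f)
   else True).

Definition smooth_on U f : Prop := forall k, Ck_on k U f.

End Calculus.

(* [cmap] and [cinv] are total functions; only their restrictions to [cdom] and
   to [cmap @` cdom] are meaningful. *)
Record chart (R : realType) (n : nat) (X : topologicalType) := Chart {
  cdom : set X;
  cmap : X -> 'rV[R]_n;
  cinv : 'rV[R]_n -> X;
  cdom_open : open cdom;
  cimg_open : open (cmap @` cdom);
  cmapK : forall x, cdom x -> cinv (cmap x) = x;
  cmap_continuous : forall x, cdom x -> {for x, continuous cmap};
  cinv_continuous : forall y, (cmap @` cdom) y -> {for y, continuous cinv}
}.

Definition cimg (R : realType) (n : nat) (X : topologicalType)
  (c : chart R n X) : set 'rV[R]_n := cmap c @` cdom c.

Definition transition (R : realType) (n : nat) (X : topologicalType)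
  (c c' : chart R n X) : 'rV[R]_n -> 'rV[R]_n := cmap c' \o cinv c.

(* The atlas is an indexed family, together with a preferred chart around each
   point; tangent and cotangent spaces are trivialised by that chart. *)
Record smooth_manifold (R : realType) (n : nat) (X : topologicalType) :=
  SmoothManifold {
  mfd_hausdorff : hausdorff_space X;
  mfd_second_countable : @second_countable X;
  idx : Type;
  atlas : idx -> chart R n X;
  idx_at : X -> idx;
  mem_chart_at : forall x, cdom (atlas (idx_at x)) x;
  atlas_compatible : forall (i j : idx) (b : 'I_n),
    smooth_on (cmap (atlas i) @` (cdom (atlas i) `&` cdom (atlas j)))
              (fun y => transition (atlas i) (atlas j) y 0 b)
}.

(* [metric i y] is the Gram matrix of the coordinate vector fields of the chart
   [i] at the point with coordinates [y]. *)
Record riemannian_metric (R : realType) (n : nat) (X : topologicalType)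
    (M : smooth_manifold R n X) := RiemannianMetric {
  metric : idx M -> 'rV[R]_n -> 'M[R]_n;
  metric_smooth : forall (i : idx M) (a b : 'I_n),
    smooth_on (cimg (atlas i)) (fun y => metric i y a b);
  metric_sym : forall (i : idx M) (y : 'rV[R]_n),
    cimg (atlas i) y -> (metric i y)^T = metric i y;
  metric_posdef : forall (i : idx M) (y v : 'rV[R]_n),
    cimg (atlas i) y -> v != 0 -> 0 < (v *m metric i y *m v^T) 0 0;
  metric_transform : forall (i j : idx M) (x : X),
    cdom (atlas i) x -> cdom (atlas j) x ->
    let J : 'M[R]_n := \matrix_(a, b)
      pd a (fun y => transition (atlas i) (atlas j) y 0 b)
         (cmap (atlas i) x) in
    metric i (cmap (atlas i) x) = J *m metric j (cmap (atlas j) x) *m J^T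
}.

Section Riemannian.
Context {R : realType} {n : nat} {X : topologicalType}.
Context {M : smooth_manifold R n X} (g : riemannian_metric M).

(* Gamma^k_{ab} of the Levi-Civita connection in the chart [i] *)
Definition christoffel (i : idx M) (y : 'rV[R]_n) (a b k : 'I_n) : R :=
  2^-1 * \sum_(l < n) invmx (metric g i y) k l *
    (pd a (fun z => metric g i z b l) y + pd b (fun z => metric g i z a l) y
     - pd l (fun z => metric g i z a b) y).

(* [jcov] and [jhess] are the components of p and A in the preferred chart at
   [jbase]. The second-order part is not restricted to symmetric matrices; the
   jet of a C^2 function always has a symmetric one. *)
Record jet2 := Jet2 {
  jbase : X;
  jval : R;
  jcov : 'rV[R]_n;
  jhess : 'M[R]_n
}.

Definition metric_at (x : X) : 'M[R]_n :=
  metric g (idx_at M x) (cmap (atlas (idx_at M x)) x).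

Definition covector_norm (x : X) (p : 'rV[R]_n) : R :=
  Num.sqrt ((p *m invmx (metric_at x) *m p^T) 0 0).

Definition metric_trace (x : X) (A : 'M[R]_n) : R :=
  \tr (invmx (metric_at x) *m A).

Definition C2_near (x : X) (phi : X -> R) : Prop :=
  let c := atlas (idx_at M x) in
  exists2 U : set 'rV[R]_n, open_nbhs (cmap c x) U &
    Ck_on 2 U (phi \o cinv c).

Definition jet2_of (x : X) (phi : X -> R) : jet2 :=
  let c := atlas (idx_at M x) in
  let f := phi \o cinv c in
  let y := cmap c x in
  Jet2 x (phi x) (\row_a pd a f y)
    (\matrix_(a, b) (pd a (pd b f) y -
       \sum_(k < n) christoffel (idx_at M x) y a b k * pd k f y)).

(* Elements of USC(Y) are represented by functions on the whole of [X] whose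
   values outside [Y] are irrelevant. *)
Definition usc_on (Y : set X) (u : X -> \bar R) : Prop :=
  forall x, Y x -> (u x < +oo)%E /\
    forall a : R, (u x < a%:E)%E ->
      \forall y \near within Y (nbhs x), (u y < a%:E)%E.

Definition is_test (u : X -> \bar R) (x : X) (phi : X -> R) : Prop :=
  [/\ C2_near x phi,
      \forall y \near x, (u y <= (phi y)%:E)%E &
      (phi x)%:E = u x].

Definition subsol_open (F : set jet2) (Omega : set X) (u : X -> \bar R) : Prop :=
  usc_on Omega u /\
  forall x phi, Omega x -> is_test u x phi -> F (jet2_of x phi).

Definition subsol_closed (F : set jet2) (K : set X) (u : X -> \bar R) : Prop :=
  usc_on K u /\ subsol_open F K° u.

Definition boundary (U : set X) : set X := closure U `\` U°.

Definition ahlfors (G : set jet2) : Prop :=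
  let H := G `|` [set j | jval j <= 0] in
  forall (U : set X) (u : X -> \bar R),
    open U -> boundary U !=set0 ->
    subsol_closed H (closure U) u ->
    (exists m : R, forall x, closure U x -> (u x <= m%:E)%E) ->
    (exists2 x, closure U x & (0 < u x)%E) ->
    ereal_sup [set maxe (u x) 0%E | x in boundary U] =
    ereal_sup [set u x | x in closure U].

Definition strong_laplacian_principle : Prop :=
  ahlfors ([set j | 1 <= metric_trace (jbase j) (jhess j)] `|`
           [set j | 1 <= covector_norm (jbase j) (jcov j)]).

(* meant for open [J] *)
Definition geodesic_on (J : set R) (gamma : R -> X) : Prop :=
  forall t, J t -> {for t, continuous gamma} /\
    forall i : idx M, cdom (atlas i) (gamma t) ->
      let c (k : 'I_n) : R -> R := fun s => cmap (atlas i) (gamma s) 0 k in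
      forall k : 'I_n,
        [/\ derivable (c k) t 1,
            derivable ((c k)^`())%classic t 1 &
            ((c k)^`()^`())%classic t +
              \sum_(a < n) \sum_(b < n)
                christoffel i (cmap (atlas i) (gamma t)) a b k *
                ((c a)^`())%classic t * ((c b)^`())%classic t = 0].

Definition geodesically_complete : Prop :=
  forall (J : set R) (gamma : R -> X),
    open J -> is_interval J -> J !=set0 -> geodesic_on J gamma ->
    exists2 gamma' : R -> X, geodesic_on setT gamma' &
      forall t, J t -> gamma' t = gamma t.

End Riemannian.

(* Main.v *)
Require Import Defs.
From mathcomp Require Import all_boot all_order all_algebra.
From mathcomp Require Import all_classical all_reals all_analysis.
From mathcomp Require Import ring lra.

Set Implicit Arguments.
Unset Strict Implicit.
Unset Printing Implicit Defensive.
Import Order.TTheory GRing.Theory Num.Theory.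
Import numFieldNormedType.Exports.

Local Open Scope classical_set_scope.
Local Open Scope ring_scope.

(** Incompleteness means that some geodesic [gamma] defined up to a finite time
    [T] cannot be continued past [T]. Such a geodesic has constant speed, hence
    finite length, and this leaves two possibilities as [t] tends to [T].

    If [gamma t] has no accumulation point, the principle is violated by the
    passage time: let [u] be [-oo] off the curve, and [K * (t - t0)] at a point
    whose last visit takes place at the time [t]. Escape to infinity makes [u]
    upper semicontinuous. A test function touching [u] from above at [gamma t]
    dominates [K * (s - t0)] at [gamma s] for [s >= t], so its derivative along
    [gamma'] is at least [K], and its gradient has norm at least 1 as soon as [K]
    exceeds the speed ([passage_time_test]). Thus [u] is admissible, bounded by
    [K * (T - t0)], and this bound is its supremum on the complement of
    [gamma t0]; but on the boundary, which is the point [gamma t0], the value of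
    [u] is smaller ([accumulation_point]).

    If [gamma t] accumulates at [x], then near [x] the coordinates of [gamma] have
    bounded velocity and acceleration, so position and velocity converge as [t]
    tends to [T], and the geodesic with the limits as initial data continues
    [gamma] ([extend_at_accumulation]). This rests on local existence for ordinary
    differential equations ([picard_local]) and on the fact that the geodesic
    equation of one chart implies that of the others ([geodesic_at_change]). The
    latter, like the constancy of the speed ([energy_cst]), is derived from the
    Euler-Lagrange form of the equation ([christoffel_euler_lagrange]).

    Hence a maximal extension of a geodesic ([maximal_extension]) is defined on an
    interval without upper bound and, by time reversal, without lower bound. *)

(** * Calculus in one variable *)

Section OneVariable.
Context {R : realType}.
Implicit Types (f g : R -> R) (s t : R).

Lemma is_derive_ext f g t d : f =1 g -> is_derive t 1 f d -> is_derive t 1 g d.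
Proof. by move=> /funext ->. Qed.

Lemma is_derive_mul f g t df dg :
  is_derive t 1 f df -> is_derive t 1 g dg ->
  is_derive t 1 (fun s => f s * g s) (df * g t + f t * dg).
Proof.
move=> hf hg; have H := is_deriveM hf hg.
rewrite (_ : (fun s => _) = (f * g)%R)//.
by apply: (is_derive_eq H); rewrite addrC [df * _]mulrC.
Qed.

Lemma is_derive_bigsum m (h : 'I_m -> R -> R) t (dh : 'I_m -> R) :
  (forall i, is_derive t 1 (h i) (dh i)) ->
  is_derive t 1 (fun s => \sum_(i < m) h i s) (\sum_(i < m) dh i).
Proof.
move=> H; have := is_derive_sum H.
by rewrite (_ : \sum_(i < m) h i = fun s => \sum_(i < m) h i s)//
  funeqE => s; rewrite fct_sumE.
Qed.

Lemma cvg_bigsum (T : Type) (F : set_system T) m (h : 'I_m -> T -> R)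
    (l : 'I_m -> R) : Filter F ->
  (forall i, h i x @[x --> F] --> l i) ->
  \sum_(i < m) h i x @[x --> F] --> \sum_(i < m) l i.
Proof.
move=> FF H; elim: m h l H => [|m IH] h l H.
  by under eq_cvg do rewrite big_ord0; rewrite big_ord0; exact: cvg_cst.
under eq_cvg do rewrite big_ord_recr; rewrite big_ord_recr/=.
by apply: cvgD => //; apply: IH.
Qed.

Lemma is_derive_continuous f t df : is_derive t 1 f df -> {for t, continuous f}.
Proof.
by move=> [/derivable1_diffP d _]; exact: differentiable_continuous.
Qed.

Lemma is_derive_cvgP f t d :
  is_derive t 1 f d <-> h^-1 * (f (t + h) - f t) @[h --> 0^'] --> d.
Proof.
have E : (fun h : R => h^-1 *: ((f \o shift t) (h *: 1) - f t))
       = (fun h => h^-1 * (f (t + h) - f t)).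
  by rewrite funeqE => h /=; congr (_ * (f _ - _)); rewrite [_ *: _]mulr1 addrC.
split=> [[+ <-]|H].
  by rewrite /derivable/derive E.
split; first by rewrite /derivable E; apply/cvg_ex; exists d.
by rewrite /derive E; exact: cvg_lim.
Qed.

Lemma is_derive_line {V : normedModType R} (f : V -> R) (p v : V) (c s d : R) :
  is_derive (p + (s * c) *: v) v f d ->
  is_derive s 1 (fun s => f (p + (s * c) *: v)) (c * d).
Proof.
move=> [df <-].
have H : is_derive (s * c) (1 : R) (fun r => f (p + r *: v)) ('D_v f (p + (s * c) *: v)).
  have E : (fun h : R => h^-1 *: (((fun r => f (p + r *: v)) \o shift (s * c)) (h *: 1)
             - f (p + (s * c) *: v)))
     = (fun h => h^-1 *: ((f \o shift (p + (s * c) *: v)) (h *: v) - f (p + (s * c) *: v))).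
    rewrite funeqE => h /=; congr (_ *: (f _ - _)).
    by rewrite [_ *: 1]mulr1 scalerDl addrCA.
  by apply: DeriveDef; [rewrite /derivable E; exact: df|rewrite /derive E].
have H2 : is_derive s (1 : R) (fun s : R => s * c) c.
  have := @is_derive_mul id (cst c) s 1 0 _ _.
  by rewrite mul1r mulr0 addr0; apply.
have := @is_derive1_comp R (fun r => f (p + r *: v)) (fun s => s * c) _ _ _ H H2.
by rewrite [X in is_derive _ _ _ X]mulrC.
Qed.

Lemma MVT_closed f df (a b : R) : a < b ->
  (forall x, a <= x <= b -> is_derive x 1 f (df x)) ->
  exists2 c, a < c < b & f b - f a = df c * (b - a).
Proof.
move=> ab H; have [||c cab E] := @MVT R f df a b ab.
- by move=> x; rewrite in_itv/= => /andP[xa xb]; apply: H; rewrite !ltW.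
- apply: continuous_in_subspaceT => x; rewrite inE/= in_itv/= => xab.
  exact: is_derive_continuous (H _ xab).
- by exists c => //; move: cab; rewrite in_itv.
Qed.

End OneVariable.

(** * Functions of class C^k of several variables *)

Section SeveralVariables.
Context {R : realType} {n : nat}.
Implicit Types (U : set 'rV[R]_n) (f : 'rV[R]_n -> R) (x y h : 'rV[R]_n).

Lemma coord_le_norm x a : `|x 0 a| <= `|x|.
Proof.
rewrite [leRHS]/Num.Def.normr/= mx_normrE.
exact: (le_bigmax _ (fun ij => `|x ij.1 ij.2|) (0, a)).
Qed.

Lemma norm_le_coord x (e : R) :
  0 <= e -> (forall a, `|x 0 a| <= e) -> `|x| <= e.
Proof.
move=> e0 H; rewrite [leLHS]/Num.Def.normr/= mx_normrE.
by apply/bigmax_leP; split=> // -[i a] _ /=; rewrite (ord1 i).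
Qed.

Lemma near_normP y (P : set 'rV[R]_n) :
  (\forall z \near y, P z) <-> exists2 r : R, 0 < r & forall z, `|z - y| < r -> P z.
Proof.
split=> [/nbhs_ballP[r r0 H]|[r r0 H]].
  by exists r => // z zr; apply: H; rewrite -ball_normE/= distrC.
apply/nbhs_ballP; exists r => // z; rewrite -ball_normE/= => zr.
by apply: H; rewrite distrC.
Qed.

(** The increment is split into one step per coordinate, and each step is
    controlled by the one-variable mean value theorem. *)
Lemma increment_partial f y h (r : R) :
  (forall z a, `|z - y| < r -> derivable f z (delta_mx 0 a)) -> `|h| < r ->
  exists xi : 'I_n -> 'rV[R]_n, (forall a, `|xi a - y| <= `|h|) /\
    f (y + h) - f y = \sum_(a < n) h 0 a * pd a f (xi a).
Proof.
move=> df hr.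
(* [p k] has its first [k] coordinates in common with [y + h]. *)
pose p k : 'rV[R]_n := y + \row_a (if (a < k)%N then h 0 a else 0).
have p0 : p 0%N = y.
  by rewrite /p (_ : \row_a _ = 0) ?addr0//; apply/rowP => a; rewrite !mxE.
have pn : p n = y + h.
  by rewrite /p; congr (_ + _); apply/rowP => a; rewrite !mxE ltn_ord.
have pS (a : 'I_n) : p a.+1 = p a + h 0 a *: delta_mx 0 a.
  rewrite /p -addrA; congr (_ + _); apply/rowP => b; rewrite !mxE ltnS eqxx/=.
  have [->|ab] := eqVneq b a; first by rewrite leqnn ltnn mulr1 add0r.
  by rewrite mulr0 addr0 leq_eqVlt (inj_eq val_inj) (negbTE ab).
have step (a : 'I_n) : exists2 xi, `|xi - y| <= `|h| &
    f (p a.+1) - f (p a) = h 0 a * pd a f xi.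
  have near_p s : 0 <= s <= 1 ->
      `|p a + (s * h 0 a) *: delta_mx 0 a - y| <= `|h|.
    move=> /andP[s0 s1]; apply: norm_le_coord => // b.
    have hb := coord_le_norm h b.
    rewrite /p addrAC [y + _]addrC addrK !mxE eqxx/=.
    have [->|ab] := eqVneq b a.
      rewrite ltnn add0r mulr1 normrM (ger0_norm s0).
      by apply: le_trans (coord_le_norm h a); rewrite ler_piMl.
    by rewrite mulr0 addr0; case: ifP => // _; rewrite normr0.
  have [||s s01 E] := @MVT_closed R (fun s => f (p a + (s * h 0 a) *: delta_mx 0 a))
     (fun s => h 0 a * pd a f (p a + (s * h 0 a) *: delta_mx 0 a)) 0 1.
  - exact: ltr01.
  - move=> s s01; apply: is_derive_line; apply: derivableP; apply: df.
    exact: le_lt_trans (near_p _ s01) hr.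
  exists (p a + (s * h 0 a) *: delta_mx 0 a).
    by apply: near_p; case/andP: s01 => s0 s1; rewrite !ltW.
  by move: E; rewrite mul1r mul0r scale0r addr0 subr0 mulr1 -pS.
have [xi xiP] := choice (fun a => (let: ex_intro2 z zh zE := step a in
  ex_intro (fun z => `|z - y| <= `|h| /\ f (p a.+1) - f (p a) = h 0 a * pd a f z) z
    (conj zh zE))).
exists xi; split=> [a|]; first by case: (xiP a).
rewrite -pn -{1}p0 -(telescope_sumr (f \o p) (leq0n n)) big_mkord.
by apply: eq_bigr => a _; case: (xiP a).
Qed.

Lemma Ck_onS k U f : Ck_on k.+1 U f -> Ck_on k U f.
Proof.
elim: k f => [|k IH] f [cf df]; first by split.
by split=> // a; have [da Ca] := df a; split=> //; exact: IH.
Qed.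

(** By [increment_partial] the difference quotient is a sum of quotients of the
    coordinates of [c], multiplied by partial derivatives of [f] at points that
    tend to [c t]; the latter converge by continuity. *)
Lemma is_derive_curve U f (c : R -> 'rV[R]_n) t (z : 'I_n -> R) :
  open U -> Ck_on 1 U f -> U (c t) ->
  (forall a, is_derive t 1 (fun s => c s 0 a) (z a)) ->
  is_derive t 1 (fun s => f (c s)) (\sum_(a < n) z a * pd a f (c t)).
Proof.
move=> oU [cf df] Ut dc.
have cc a : {for t, continuous (fun s => c s 0 a)}.
  exact: is_derive_continuous (dc a).
have [r r0 rU] : exists2 r : R, 0 < r & forall z, `|z - c t| < r -> U z.
  by apply/near_normP; exact: open_nbhs_nbhs.
have cnear e : 0 < e -> \forall h \near 0^', `|c (t + h) - c t| < e.
  move=> e0; have e2 : 0 < e / 2 by rewrite divr_gt0.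
  have H a : \forall h \near 0^', `|c (t + h) 0 a - c t 0 a| <= e / 2.
    apply: nbhs_dnbhs; have /cvgrPdist_le/(_ _ e2) := cc a.
    move=> /nbhs_ballP[d d0 dP]; apply/nbhs_ballP; exists d => // h.
    rewrite -ball_normE/= sub0r normrN => hd; rewrite distrC; apply: dP.
    by rewrite -ball_normE/= opprD addrA subrr sub0r normrN.
  near=> h; apply: (@le_lt_trans _ _ (e / 2)); last first.
    by rewrite ltr_pdivrMr// ltr_pMr// ltr1n.
  apply: norm_le_coord; first exact: ltW.
  move=> a; rewrite !mxE; move: a; near: h; exact: filter_forall.
have /choice[xi xiP] : forall h : R, exists xi : 'I_n -> 'rV[R]_n,
    `|c (t + h) - c t| < r -> (forall a, `|xi a - c t| <= `|c (t + h) - c t|) /\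
    f (c (t + h)) - f (c t) = \sum_(a < n) (c (t + h) 0 a - c t 0 a) * pd a f (xi a).
  move=> h; have [hr|_] := boolP (`|c (t + h) - c t| < r); last by exists (fun=> 0).
  have [|xi [xi1 xi2]] := @increment_partial f (c t) (c (t + h) - c t) r _ hr.
    by move=> y a /rU Uy; exact: (df a).1.
  exists xi => _; split=> //.
  move: xi2; rewrite [c t + _]addrC subrK => ->.
  by apply: eq_bigr => a _; rewrite !mxE.
apply/is_derive_cvgP.
suff H : \sum_(a < n) (h^-1 * (c (t + h) 0 a - c t 0 a)) * pd a f (xi h a)
    @[h --> 0^'] --> \sum_(a < n) z a * pd a f (c t).
  apply: cvg_trans H; apply: near_eq_cvg; near=> h.
  have [|_ ->] := xiP h; first by near: h; exact: cnear.
  by rewrite mulr_sumr; apply: eq_bigr => a _; rewrite mulrA.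
apply: cvg_bigsum => a; apply: cvgM.
  by have /is_derive_cvgP := dc a.
have pdc : {for c t, continuous (pd a f)} by case: (df a) => _ [+ _]; exact.
apply/cvgrPdist_lt => e e0; move/cvgrPdist_lt : pdc => /(_ _ e0).
move=> /near_normP[d d0 dP]; near=> h; apply: dP.
have [|+ _] := xiP h; first by near: h; exact: cnear.
move=> /(_ a) /le_lt_trans; apply; near: h; exact: cnear.
Unshelve. all: by end_near. Qed.

End SeveralVariables.

(** * Equality of mixed partial derivatives *)

Section Clairaut.
Context {R : realType} {n : nat}.
Implicit Types (U : set 'rV[R]_n) (f : 'rV[R]_n -> R) (x y h : 'rV[R]_n).

Lemma norm_delta_le (a : 'I_n) : `|delta_mx 0 a : 'rV[R]_n| <= 1.
Proof.
apply: norm_le_coord => // b; rewrite !mxE eqxx/=.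
by case: (b == a); rewrite ?normr1 ?normr0.
Qed.

Lemma dist_le_split (u v w e : R) :
  `|v - u| <= e / 2 -> `|w - u| <= e / 2 -> `|v - w| <= e.
Proof.
move=> vu wu; apply: le_trans (ler_distD u _ _) _.
by rewrite (splitr e) lerD// distrC.
Qed.

Lemma second_differenceC (V : zmodType) (f : V -> R) (y u v : V) :
  f (y + u + v) - f (y + v) - (f (y + u) - f y) =
  f (y + v + u) - f (y + u) - (f (y + v) - f y).
Proof. by rewrite !opprB addrACA [- _ + _]addrC -addrACA [y + u + v]addrAC. Qed.

(** Two applications of the mean value theorem, first in the direction [a] to a
    difference in the direction [b], then in the direction [b]. *)
Lemma second_difference U f y (a b : 'I_n) (h r : R) :
  Ck_on 2 U f -> (forall z, `|z - y| < r -> U z) -> 0 < h -> h + h < r ->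
  exists2 z, `|z - y| <= h + h &
    f (y + h *: delta_mx 0 b + h *: delta_mx 0 a) - f (y + h *: delta_mx 0 a)
    - (f (y + h *: delta_mx 0 b) - f y) = h * h * pd b (pd a f) z.
Proof.
move=> [_ df] rU h0 hr.
have near_y s u : 0 <= s <= 1 -> 0 <= u <= 1 ->
    `|y + (u * h) *: delta_mx 0 b + (s * h) *: delta_mx 0 a - y| <= h + h.
  move=> /andP[s0 s1] /andP[u0 u1]; rewrite addrAC [y + _]addrC addrK.
  have le_h (c : R) (i : 'I_n) : 0 <= c -> c <= 1 ->
      `|(c * h) *: (delta_mx 0 i : 'rV[R]_n)| <= h.
    move=> c0 c1; have hw := ltW h0; rewrite normrZ ger0_norm ?mulr_ge0//.
    apply: (@le_trans _ _ (c * h)); last by rewrite ler_piMl.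
    by rewrite ler_piMr ?norm_delta_le// mulr_ge0.
  by apply: le_trans (ler_normD _ _) _; rewrite lerD// le_h.
have inU s u : 0 <= s <= 1 -> 0 <= u <= 1 ->
    U (y + (u * h) *: delta_mx 0 b + (s * h) *: delta_mx 0 a).
  by move=> s01 u01; apply: rU; exact: le_lt_trans (near_y _ _ s01 u01) hr.
have i1 : 0 <= (1 : R) <= 1 by rewrite ler01 lexx.
have i0 : 0 <= (0 : R) <= 1 by rewrite lexx ler01.
have [||s s01 Es] := @MVT_closed R
  (fun s => f (y + (1 * h) *: delta_mx 0 b + (s * h) *: delta_mx 0 a) -
            f (y + (0 * h) *: delta_mx 0 b + (s * h) *: delta_mx 0 a))
  (fun s => h * pd a f (y + (1 * h) *: delta_mx 0 b + (s * h) *: delta_mx 0 a) -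
            h * pd a f (y + (0 * h) *: delta_mx 0 b + (s * h) *: delta_mx 0 a)) 0 1.
- exact: ltr01.
- move=> s s01; apply: is_deriveB; apply: is_derive_line; apply: derivableP.
  + by apply: (df a).1; exact: inU.
  + by apply: (df a).1; exact: inU.
have {}s01 : 0 <= s <= 1 by case/andP: s01 => ? ?; rewrite !ltW.
have [||u u01 Eu] := @MVT_closed R
  (fun u => pd a f (y + (s * h) *: delta_mx 0 a + (u * h) *: delta_mx 0 b))
  (fun u => h * pd b (pd a f) (y + (s * h) *: delta_mx 0 a + (u * h) *: delta_mx 0 b))
  0 1.
- exact: ltr01.
- move=> u u01; apply: is_derive_line; apply: derivableP.
  by have [_ [_ /(_ b) [+ _]]] := df a; apply; rewrite addrAC; exact: inU.
have {}u01 : 0 <= u <= 1 by case/andP: u01 => ? ?; rewrite !ltW.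
exists (y + (u * h) *: delta_mx 0 b + (s * h) *: delta_mx 0 a).
  exact: near_y.
move: Es Eu; rewrite !mul1r !mul0r !scale0r !addr0 !subr0 !mulr1 -mulrBr.
rewrite [y + (s * h) *: _ + h *: _]addrAC => -> ->.
by rewrite mulrA [y + (s * h) *: _ + _]addrAC.
Qed.

(** The second difference is symmetric in the two directions, so that both mixed
    derivatives take a common value at points arbitrarily close to [y]. *)
Lemma pd_comm U f y (a b : 'I_n) : open U -> Ck_on 2 U f -> U y ->
  pd a (pd b f) y = pd b (pd a f) y.
Proof.
move=> oU Cf Uy.
have [r r0 rU] : exists2 r : R, 0 < r & forall z, `|z - y| < r -> U z.
  by apply/near_normP; exact: open_nbhs_nbhs.
have cpd (i j : 'I_n) : {for y, continuous (pd i (pd j f))}.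
  by case: Cf => _ /(_ j) [_ [_ /(_ i) [_ [+ _]]]]; exact.
apply/eqP; rewrite -subr_eq0 -normr_le0; apply/ler_addgt0Pl => e e0.
rewrite addr0; have e2 : 0 < e / 2 by rewrite divr_gt0.
have /cvgrPdist_le/(_ _ e2)/near_normP[d1 d10 H1] := cpd a b.
have /cvgrPdist_le/(_ _ e2)/near_normP[d2 d20 H2] := cpd b a.
pose d := Num.min r (Num.min d1 d2).
have d0 : 0 < d by rewrite !lt_min r0 d10 d20.
have h0 : 0 < d / 3 by rewrite divr_gt0.
have hd : d / 3 + d / 3 < d by lra.
have [dr dd1 dd2] : [/\ d <= r, d <= d1 & d <= d2].
  by rewrite /d !ge_min !lexx !orbT.
have [z1 z1y E1] := second_difference b a Cf rU h0 (lt_le_trans hd dr).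
have [z2 z2y E2] := second_difference a b Cf rU h0 (lt_le_trans hd dr).
have {E1 E2} E : pd a (pd b f) z1 = pd b (pd a f) z2.
  apply: (@mulfI _ (d / 3 * (d / 3))); first by rewrite mulf_neq0// gt_eqF.
  by apply: etrans (esym E1) (etrans _ E2); exact: second_differenceC.
have {}H1 := H1 z1 (le_lt_trans z1y (lt_le_trans hd dd1)).
have {}H2 := H2 z2 (le_lt_trans z2y (lt_le_trans hd dd2)).
by rewrite E in H1; exact: dist_le_split H1 H2.
Qed.

End Clairaut.

(** * Locally Lipschitz functions *)

Section LocallyLipschitz.
Context {R : realType} {n : nat}.
Implicit Types (f g : 'rV[R]_n -> R) (x y z : 'rV[R]_n).

(** This class contains the C^1 functions and is large enough for Picard
    iteration, while its stability under products, inverses and determinants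
    follows from elementary estimates. *)
Definition loc_lipschitz x f := exists C r : R, [/\ 0 <= C, 0 < r &
  forall y z, `|y - x| < r -> `|z - x| < r -> `|f y - f z| <= C * `|y - z|].

Lemma loc_lipschitz_cvg x f : loc_lipschitz x f -> {for x, continuous f}.
Proof.
move=> [C [r [C0 r0 H]]].
apply/(@cvgrPdist_le _ _ _ (nbhs x) (nbhs_filter x)) => e e0; apply/near_normP.
have C1 : 0 < C + 1 by rewrite ltr_wpDl.
exists (Num.min r (e / (C + 1))); first by rewrite lt_min r0 divr_gt0.
move=> z; rewrite lt_min => /andP[zr ze].
apply: le_trans (H x z _ zr) _; first by rewrite subrr normr0.
apply: (@le_trans _ _ ((C + 1) * `|x - z|)); first by rewrite ler_wpM2r// lerDl.
by rewrite mulrC -ler_pdivlMr// distrC ltW.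
Qed.

Lemma loc_lipschitz_bounded x f : loc_lipschitz x f ->
  exists B r : R, [/\ 0 <= B, 0 < r & forall y, `|y - x| < r -> `|f y| <= B].
Proof.
move=> [C [r [C0 r0 H]]]; exists (`|f x| + C * r), r.
split=> //; first by rewrite addr_ge0// mulr_ge0// ltW.
move=> y yr; rewrite -(subrK (f x) (f y)) addrC (le_trans (ler_normD _ _))//.
rewrite lerD2l; apply: le_trans (H _ x yr _) _; first by rewrite subrr normr0.
by rewrite ler_wpM2l// ltW.
Qed.

Lemma loc_lipschitz_cst x (c : R) : loc_lipschitz x (fun=> c).
Proof.
by exists 0, 1; split=> // y z _ _; rewrite subrr normr0 mul0r.
Qed.

Lemma loc_lipschitz_coord x (a : 'I_n) : loc_lipschitz x (fun y => y 0 a).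
Proof.
exists 1, 1; split=> // y z _ _; rewrite mul1r.
by have := coord_le_norm (y - z) a; rewrite !mxE.
Qed.

Lemma loc_lipschitzD x f g : loc_lipschitz x f -> loc_lipschitz x g ->
  loc_lipschitz x (fun y => f y + g y).
Proof.
move=> [C [r [C0 r0 H]]] [D [s [D0 s0 K]]].
exists (C + D), (Num.min r s); split; [exact: addr_ge0|by rewrite lt_min r0|].
move=> y z; rewrite !lt_min => /andP[yr ys] /andP[zr zs].
rewrite opprD addrACA (le_trans (ler_normD _ _))// mulrDl.
by rewrite lerD ?H ?K.
Qed.

Lemma loc_lipschitzM x f g : loc_lipschitz x f -> loc_lipschitz x g ->
  loc_lipschitz x (fun y => f y * g y).
Proof.
move=> Lf Lg.
have [B [r1 [B0 r10 HB]]] := loc_lipschitz_bounded Lf.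
have [B' [s1 [B'0 s10 HB']]] := loc_lipschitz_bounded Lg.
move: Lf Lg => [C [r [C0 r0 H]]] [D [s [D0 s0 K]]].
exists (B * D + C * B'), (Num.min (Num.min r s) (Num.min r1 s1)); split.
- by rewrite addr_ge0// mulr_ge0.
- by rewrite !lt_min r0 s0 r10.
move=> y z; rewrite !lt_min.
move=> /andP[/andP[yr ys] /andP[yr1 ys1]] /andP[/andP[zr zs] /andP[zr1 zs1]].
have -> : f y * g y - f z * g z = f y * (g y - g z) + (f y - f z) * g z by ring.
apply: le_trans (ler_normD _ _) _; rewrite [leRHS]mulrDl !normrM lerD//.
  by rewrite -mulrA ler_pM ?HB ?K.
by rewrite mulrAC ler_pM ?H ?HB'.
Qed.

Lemma loc_lipschitzV x f : loc_lipschitz x f -> f x != 0 ->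
  loc_lipschitz x (fun y => (f y)^-1).
Proof.
move=> Lf fx0; have cf := loc_lipschitz_cvg Lf.
move: Lf => [C [r [C0 r0 H]]].
have m0 : 0 < `|f x| / 2 by rewrite divr_gt0// normr_gt0.
have /cvgrPdist_le/(_ _ m0)/near_normP[d d0 dP] := cf.
have low y : `|y - x| < d -> `|f x| / 2 <= `|f y|.
  move=> /dP h; have h' := lerB_dist (f x) (f x - f y); rewrite subKr in h'.
  clear -h h'; lra.
set m := `|f x| / 2 in m0 low.
exists (C * (m^-1 * m^-1)), (Num.min r d); split.
- by rewrite mulr_ge0// mulr_ge0// invr_ge0 ltW.
- by rewrite lt_min r0.
move=> y z; rewrite !lt_min => /andP[yr yd] /andP[zr zd].
have fy0 : 0 < `|f y| := lt_le_trans m0 (low _ yd).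
have fz0 : 0 < `|f z| := lt_le_trans m0 (low _ zd).
have -> : (f y)^-1 - (f z)^-1 = (f z - f y) * ((f y)^-1 * (f z)^-1).
  by move: fy0 fz0; rewrite !normr_gt0 => fy0 fz0; field; rewrite ?fy0 ?fz0.
rewrite normrM mulrAC ler_pM//; first by rewrite distrC H.
by rewrite normrM !normfV ler_pM ?invr_ge0// lef_pV2 ?posrE// low.
Qed.

Lemma loc_lipschitz_sum x (I : Type) (s : seq I) (P : pred I)
    (h : I -> 'rV[R]_n -> R) :
  (forall i, loc_lipschitz x (h i)) ->
  loc_lipschitz x (fun y => \sum_(i <- s | P i) h i y).
Proof.
move=> H; elim: s => [|i s IH].
  under eq_fun do rewrite big_nil; exact: loc_lipschitz_cst.
under eq_fun do rewrite big_cons; case: (P i) => //; exact: loc_lipschitzD.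
Qed.

Lemma loc_lipschitz_prod x (I : Type) (s : seq I) (P : pred I)
    (h : I -> 'rV[R]_n -> R) :
  (forall i, loc_lipschitz x (h i)) ->
  loc_lipschitz x (fun y => \prod_(i <- s | P i) h i y).
Proof.
move=> H; elim: s => [|i s IH].
  under eq_fun do rewrite big_nil; exact: loc_lipschitz_cst.
under eq_fun do rewrite big_cons; case: (P i) => //; exact: loc_lipschitzM.
Qed.

Lemma loc_lipschitz_det x m (A : 'rV[R]_n -> 'M[R]_m) :
  (forall i j, loc_lipschitz x (fun y => A y i j)) ->
  loc_lipschitz x (fun y => \det (A y)).
Proof.
move=> H; rewrite /determinant; apply: loc_lipschitz_sum => s.
apply: loc_lipschitzM; first exact: loc_lipschitz_cst.
exact: loc_lipschitz_prod.
Qed.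

Lemma loc_lipschitz_near x f g (r : R) : 0 < r ->
  (forall y, `|y - x| < r -> f y = g y) -> loc_lipschitz x f -> loc_lipschitz x g.
Proof.
move=> r0 fg [C [s [C0 s0 H]]]; exists C, (Num.min r s).
split=> //; first by rewrite lt_min r0.
move=> y z; rewrite !lt_min => /andP[yr ys] /andP[zr zs].
by rewrite -!fg// H.
Qed.

(** Cramer's rule writes the entries of the inverse as quotients of determinants. *)
Lemma loc_lipschitz_invmx x m (A : 'rV[R]_n -> 'M[R]_m) (r : R) : 0 < r ->
  (forall y, `|y - x| < r -> A y \in unitmx) ->
  (forall i j, loc_lipschitz x (fun y => A y i j)) ->
  forall i j, loc_lipschitz x (fun y => invmx (A y) i j).
Proof.
move=> r0 uA H i j.
apply: (loc_lipschitz_near (f := fun y => (\det (A y))^-1 * cofactor (A y) j i) r0).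
  by move=> y /uA u; rewrite /invmx u !mxE.
apply: loc_lipschitzM.
  apply: loc_lipschitzV; first exact: loc_lipschitz_det.
  have := uA x; rewrite subrr normr0 => /(_ r0).
  by rewrite unitmxE unitfE.
rewrite /cofactor; apply: loc_lipschitzM; first exact: loc_lipschitz_cst.
apply: loc_lipschitz_det => k l.
by under eq_fun do rewrite !mxE; exact: H.
Qed.

Lemma loc_lipschitz_C1 U f x : open U -> Ck_on 1 U f -> U x -> loc_lipschitz x f.
Proof.
move=> oU [_ df] Ux.
have [r r0 rU] : exists2 r : R, 0 < r & forall z, `|z - x| < r -> U z.
  by apply/near_normP; exact: open_nbhs_nbhs.
have bnd : \forall z \near x, forall a, `|pd a f z| <= `|pd a f x| + 1.
  apply: (@filter_forall _ _ _ (nbhs x) (nbhs_filter x)) => a.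
  have /cvgrPdist_le/(_ _ ltr01) : {for x, continuous (pd a f)}.
    by case: (df a) => _ [+ _]; exact.
  apply: filterS => z; rewrite distrC => h.
  by rewrite -[X in `|X|](subrK (pd a f x)) (le_trans (ler_normD _ _))// addrC lerD2l.
have /near_normP[d d0 dP] := bnd.
pose C := \sum_(a < n) (`|pd a f x| + 1).
pose e := Num.min r d / 3.
have e0 : 0 < e by rewrite divr_gt0// lt_min r0.
have [er ed] : 3 * e <= r /\ 3 * e <= d.
  by rewrite /e mulrC divfK// !ge_min !lexx orbT.
exists C, e; split=> //.
  by apply: sumr_ge0 => a _; rewrite addr_ge0.
move=> y z ye ze.
have hyz : `|z - y| < 2 * e.
  apply: le_lt_trans (ler_distD x _ _) _; rewrite [`|x - y|]distrC; lra.
have [|xi [xi1 xi2]] := @increment_partial R n f y (z - y) (2 * e) _ hyz.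
  move=> u a ue; apply: (df a).1; apply: rU; apply: lt_le_trans er.
  apply: le_lt_trans (ler_distD y _ _) _; lra.
rewrite distrC; move: xi2; rewrite [y + _]addrC subrK => ->.
apply: le_trans (ler_norm_sum _ _ _) _; rewrite /C mulr_suml.
apply: ler_sum => a _; rewrite normrM mulrC distrC ler_pM//; last first.
  exact: coord_le_norm.
apply: dP; apply: lt_le_trans ed.
apply: le_lt_trans (ler_distD y _ _) _; have h1 := xi1 a; lra.
Qed.

End LocallyLipschitz.

(** * Positive definite forms and the Euler-Lagrange equation *)

Section LinearAlgebra.
Context {R : realType} {n : nat}.
Implicit Types (G : 'M[R]_n) (p h v w : 'rV[R]_n).

Definition posdef G := G^T = G /\ forall v, v != 0 -> 0 < (v *m G *m v^T) 0 0.

Lemma posdef_unit G : posdef G -> G \in unitmx.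
Proof.
move=> [_ pG]; rewrite -row_free_unit -kermx_eq0; apply/negPn/negP => /rowV0Pn.
move=> [v /sub_kermxP vG v0]; have := pG _ v0.
by rewrite vG mul0mx mxE ltxx.
Qed.

Lemma posdef_ge0 G v : posdef G -> 0 <= (v *m G *m v^T) 0 0.
Proof.
move=> [_ pG]; have [->|v0] := eqVneq v 0; first by rewrite !mul0mx mxE.
exact: ltW (pG _ v0).
Qed.

Lemma form_sym G v w : G^T = G -> (v *m G *m w^T) 0 0 = (w *m G *m v^T) 0 0.
Proof.
move=> sG; have -> : v *m G *m w^T = (w *m G *m v^T)^T.
  by rewrite !trmx_mul trmxK sG mulmxA.
by rewrite mxE.
Qed.

(** Cauchy-Schwarz between a covector and a vector, for the form [G] and its
    dual: expand the nonnegative number [v G v^T] at [v = (h G h^T) p G^-1 - (p h^T) h]. *)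
Lemma dual_cauchy_schwarz G p h : posdef G ->
  (p *m h^T) 0 0 ^+ 2 <= (p *m invmx G *m p^T) 0 0 * (h *m G *m h^T) 0 0.
Proof.
move=> pG; have uG := posdef_unit pG; have sG := pG.1.
have [->|h0] := eqVneq h 0.
  by rewrite trmx0 !mulmx0 !mxE mulr0 expr0n.
have Qh := pG.2 _ h0.
set w := p *m invmx G.
have wG : w *m G = p by rewrite mulmxKV.
set q := (h *m G *m h^T) 0 0 in Qh *; set b := (p *m h^T) 0 0.
have -> : (w *m p^T) 0 0 = (w *m G *m w^T) 0 0.
  by rewrite -{1}wG trmx_mul mulmxA sG.
set a := (w *m G *m w^T) 0 0.
have E : ((q *: w - b *: h) *m G *m (q *: w - b *: h)^T) 0 0 = q * (q * a - b ^+ 2).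
  have bE : (w *m G *m h^T) 0 0 = b by rewrite wG.
  have bE' : (h *m G *m w^T) 0 0 = b by rewrite form_sym.
  have -> : (q *: w - b *: h)^T = q *: w^T - b *: h^T.
    by apply/matrixP => i j; rewrite !mxE.
  rewrite !(mulmxBl, mulmxBr) -!(scalemxAl, scalemxAr).
  move: bE bE'; rewrite /a /q.
  move: (w *m G *m w^T) (w *m G *m h^T) (h *m G *m w^T) (h *m G *m h^T).
  move=> m1 m2 m3 m4; rewrite !mxE => -> ->; ring.
have := posdef_ge0 (q *: w - b *: h) pG.
by rewrite E pmulr_rge0// subr_ge0 mulrC.
Qed.

Lemma formE G v w : (v *m G *m w^T) 0 0 = \sum_a \sum_b G a b * v 0 a * w 0 b.
Proof.
rewrite mxE exchange_big/=; apply: eq_bigr => b _.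
rewrite !mxE mulr_suml; apply: eq_bigr => a _.
by rewrite [v 0 a * _]mulrC.
Qed.

(** Here [D a b l] stands for the derivative of the [(b, l)] entry of the metric in
    the direction [a], [z] for a velocity and [acc] for an acceleration. The
    geodesic equation with Christoffel symbols and the Euler-Lagrange equation of
    the kinetic energy differ by multiplication with the invertible matrix [G]. *)
Lemma christoffel_euler_lagrange G (D : 'I_n -> 'I_n -> 'I_n -> R)
    (z acc : 'I_n -> R) :
  G \in unitmx -> (forall a b l, D a b l = D a l b) ->
  (forall k, acc k + \sum_(a < n) \sum_(b < n)
     (2^-1 * \sum_(l < n) invmx G k l * (D a b l + D b a l - D l a b)) * z a * z b = 0)
  <->
  (forall l, \sum_(k < n) ((\sum_(e < n) z e * D e l k) * z k + G l k * acc k) =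
     2^-1 * \sum_(a < n) \sum_(b < n) D l a b * z a * z b).
Proof.
move=> uG sD.
pose N : 'cV[R]_n := \col_l (2^-1 * \sum_(a < n) \sum_(b < n)
   (D a b l + D b a l - D l a b) * z a * z b).
pose A : 'cV[R]_n := \col_k acc k.
have E1 k : acc k + \sum_(a < n) \sum_(b < n)
     (2^-1 * \sum_(l < n) invmx G k l * (D a b l + D b a l - D l a b)) * z a * z b
    = (A + invmx G *m N) k 0.
  rewrite !mxE; congr (_ + _).
  pose T a b l := invmx G k l * (2^-1 * ((D a b l + D b a l - D l a b) * z a * z b)).
  transitivity (\sum_(a < n) \sum_(b < n) \sum_(l < n) T a b l).
    apply: eq_bigr => a _; apply: eq_bigr => b _.
    by rewrite mulr_sumr !mulr_suml; apply: eq_bigr => l _; rewrite /T; ring.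
  symmetry; transitivity (\sum_(l < n) \sum_(a < n) \sum_(b < n) T a b l).
    apply: eq_bigr => l _; rewrite mxE !mulr_sumr; apply: eq_bigr => a _.
    by rewrite !mulr_sumr.
  by rewrite exchange_big; apply: eq_bigr => a _; rewrite exchange_big.
have E2 l : \sum_(k < n) ((\sum_(e < n) z e * D e l k) * z k + G l k * acc k) -
     2^-1 * \sum_(a < n) \sum_(b < n) D l a b * z a * z b = (G *m A + N) l 0.
  rewrite big_split/= addrAC addrC !mxE; congr (_ + _).
    by apply: eq_bigr => k _; rewrite mxE.
  have S1 : \sum_(a < n) \sum_(b < n) D a b l * z a * z b =
            \sum_(k < n) (\sum_(e < n) z e * D e l k) * z k.
    rewrite exchange_big/=; apply: eq_bigr => k _; rewrite mulr_suml.
    by apply: eq_bigr => e _; rewrite sD [z e * _]mulrC.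
  have S2 : \sum_(a < n) \sum_(b < n) D b a l * z a * z b =
            \sum_(k < n) (\sum_(e < n) z e * D e l k) * z k.
    apply: eq_bigr => k _; rewrite mulr_suml.
    by apply: eq_bigr => e _; rewrite sD; ring.
  under [in RHS]eq_bigr do under eq_bigr do rewrite !mulrDl.
  under [in RHS]eq_bigr do rewrite !big_split/=.
  rewrite !big_split/= S1 S2.
  under [in RHS]eq_bigr do under eq_bigr do rewrite !mulNr.
  under [in RHS]eq_bigr do rewrite sumrN.
  rewrite sumrN; move: (\sum_(k < n) _) (\sum_(k < n) _) => s1 s2; lra.
have E0 : A + invmx G *m N = invmx G *m (G *m A + N).
  by rewrite mulmxDr mulKmx.
split=> H.
  have Z : A + invmx G *m N = 0.
    by apply/matrixP => k j; rewrite (ord1 j) -E1 H mxE.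
  move=> l; apply/eqP; rewrite -subr_eq0 E2.
  have -> : G *m A + N = G *m (A + invmx G *m N) by rewrite mulmxDr mulKVmx.
  by rewrite Z mulmx0 mxE.
have Z : G *m A + N = 0.
  by apply/matrixP => k j; rewrite (ord1 j) -E2 H subrr mxE.
by move=> k; rewrite E1 E0 Z mulmx0 mxE.
Qed.

End LinearAlgebra.

(** * Metric and kinetic energy in two charts *)

Section ChartChange.
Context {R : realType} {n : nat} {X : topologicalType}.
Context {M : smooth_manifold R n X} (g : riemannian_metric M).
Implicit Types (i j : idx M) (gamma : R -> X) (t s : R).

Definition chart_coord i gamma (k : 'I_n) : R -> R :=
  fun s => cmap (atlas i) (gamma s) 0 k.

Definition velocity i gamma (k : 'I_n) : R -> R := ((chart_coord i gamma k)^`())%classic.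

(** Convertible to the condition that [geodesic_on] imposes at the time [t] in the
    chart [i]. *)
Definition geodesic_at i gamma t : Prop := forall k : 'I_n,
  [/\ derivable (chart_coord i gamma k) t 1, derivable (velocity i gamma k) t 1 &
      ((velocity i gamma k)^`())%classic t +
      \sum_(a < n) \sum_(b < n) christoffel g i (cmap (atlas i) (gamma t)) a b k *
        velocity i gamma a t * velocity i gamma b t = 0].

Lemma metric_posdefW i y : cimg (atlas i) y -> posdef (metric g i y).
Proof.
by move=> iy; split; [exact: (Defs.metric_sym g iy)|move=> v; exact: (metric_posdef g iy)].
Qed.

Lemma cimg_cmap i x : cdom (atlas i) x -> cimg (atlas i) (cmap (atlas i) x).
Proof. by move=> ix; exists x. Qed.

Lemma chart_open i : open (cimg (atlas i)).
Proof. exact: cimg_open. Qed.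

Lemma metric_C1 i (a b : 'I_n) : Ck_on 1 (cimg (atlas i)) (fun y => metric g i y a b).
Proof. exact: metric_smooth. Qed.

Lemma pd_metric_sym i y (e a b : 'I_n) : cimg (atlas i) y ->
  pd e (fun z => metric g i z a b) y = pd e (fun z => metric g i z b a) y.
Proof.
move=> iy; apply: near_eq_derive.
have : \forall z \near y, cimg (atlas i) z.
  by apply: open_nbhs_nbhs; split=> //; exact: chart_open.
by apply: filterS => z iz; rewrite -{1}(Defs.metric_sym g iz) mxE.
Qed.

Lemma near_cdom i gamma t : cdom (atlas i) (gamma t) -> {for t, continuous gamma} ->
  \forall s \near t, cdom (atlas i) (gamma s).
Proof.
move=> it ct; apply: ct; apply: open_nbhs_nbhs; split=> //; exact: cdom_open.
Qed.

(** Multiplying the geodesic equation by the metric turns it into the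
    Euler-Lagrange equation, whose behaviour under a change of chart is simpler
    than that of the Christoffel symbols. *)
Lemma geodesic_eqP i gamma t : cdom (atlas i) (gamma t) ->
  (forall k, derivable (chart_coord i gamma k) t 1) ->
  (forall k, derivable (velocity i gamma k) t 1) ->
  (forall k, ((velocity i gamma k)^`())%classic t +
      \sum_(a < n) \sum_(b < n) christoffel g i (cmap (atlas i) (gamma t)) a b k *
        velocity i gamma a t * velocity i gamma b t = 0)
  <->
  (forall l, is_derive t 1
    (fun s => \sum_(k < n) metric g i (cmap (atlas i) (gamma s)) l k * velocity i gamma k s)
    (2^-1 * \sum_(a < n) \sum_(b < n)
      pd l (fun y => metric g i y a b) (cmap (atlas i) (gamma t)) *
      velocity i gamma a t * velocity i gamma b t)).
Proof.
move=> it dc dv; have iy := cimg_cmap it.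
set y := cmap (atlas i) (gamma t) in iy *.
pose D (a b l : 'I_n) := pd a (fun y => metric g i y b l) y.
have H := @christoffel_euler_lagrange R n (metric g i y) D
  (fun k => velocity i gamma k t) (fun k => ((velocity i gamma k)^`())%classic t)
  (posdef_unit (metric_posdefW iy)) (fun a b l => pd_metric_sym a b l iy).
have dP l : is_derive t 1
   (fun s => \sum_(k < n) metric g i (cmap (atlas i) (gamma s)) l k * velocity i gamma k s)
   (\sum_(k < n) ((\sum_(e < n) velocity i gamma e t * D e l k) * velocity i gamma k t +
      metric g i y l k * ((velocity i gamma k)^`())%classic t)).
  apply: is_derive_bigsum => k; apply: is_derive_mul.
    have := is_derive_curve (c := fun s => cmap (atlas i) (gamma s))
      (z := fun e => velocity i gamma e t) (@chart_open i) (@metric_C1 i l k) iy.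
    apply=> a; by rewrite /velocity derive1E; apply: derivableP; exact: dc.
  by rewrite derive1E; apply: derivableP; exact: dv.
split=> K.
  by move=> l; apply: is_derive_eq (dP l) _; move: l; apply/H.
apply/H => l.
by have [_ <-] := K l; have [_ <-] := dP l.
Qed.

Definition trans i j (b : 'I_n) : 'rV[R]_n -> R :=
  fun y => transition (atlas i) (atlas j) y 0 b.

Definition overlap i j : set 'rV[R]_n :=
  cmap (atlas i) @` (cdom (atlas i) `&` cdom (atlas j)).

Definition jac i j y : 'M[R]_n := \matrix_(a, b) pd a (trans i j b) y.

Lemma overlap_open i j : open (overlap i j).
Proof.
rewrite openE => y [x [ix jx] <-]; rewrite /interior.
have iy := cimg_cmap ix.
have ci := cinv_continuous iy.
have : \forall z \near cmap (atlas i) x, cimg (atlas i) z.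
  by apply: open_nbhs_nbhs; split=> //; exact: chart_open.
have : \forall z \near cmap (atlas i) x, cdom (atlas j) (cinv (atlas i) z).
  apply: ci; rewrite cmapK//; apply: open_nbhs_nbhs; split=> //; exact: cdom_open.
apply: filterS2 => z jz [x' ix' zx']; exists x' => //; split=> //.
by move: jz; rewrite -zx' cmapK.
Qed.

Lemma trans_Ck k i j b : Ck_on k (overlap i j) (trans i j b).
Proof. exact: atlas_compatible. Qed.

Lemma jac_C1 i j (a b : 'I_n) : Ck_on 1 (overlap i j) (pd a (trans i j b)).
Proof. exact: ((@trans_Ck 2 i j b).2 a).2. Qed.

Lemma transE i j b x : cdom (atlas i) x ->
  trans i j b (cmap (atlas i) x) = cmap (atlas j) x 0 b.
Proof. by move=> ix; rewrite /trans/transition/= cmapK. Qed.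

Lemma overlap_cimg i j y : overlap i j y -> cimg (atlas i) y.
Proof. by move=> [x [ix _] <-]; exists x. Qed.

Lemma overlap_trans i j y : overlap i j y ->
  cimg (atlas j) (transition (atlas i) (atlas j) y).
Proof. by move=> [x [ix jx] <-]; rewrite /transition/= cmapK//; exists x. Qed.

Lemma metric_overlap i j y : overlap i j y ->
  metric g i y = jac i j y *m metric g j (transition (atlas i) (atlas j) y) *m (jac i j y)^T.
Proof.
move=> [x [ix jx] <-]; rewrite (metric_transform g ix jx)/=.
by rewrite /transition/= cmapK.
Qed.

Lemma jac_unit i j y : overlap i j y -> jac i j y \in unitmx.
Proof.
move=> oy; have := posdef_unit (metric_posdefW (overlap_cimg oy)).
by rewrite (metric_overlap oy) !unitmx_mul => /andP[/andP[]].
Qed.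

Lemma metric_overlapE i j y (a b : 'I_n) : overlap i j y ->
  metric g i y a b = \sum_(p < n) \sum_(q < n) jac i j y a p * jac i j y b q *
    metric g j (transition (atlas i) (atlas j) y) p q.
Proof.
move=> oy; rewrite (metric_overlap oy) mxE exchange_big; apply: eq_bigr => q _.
rewrite mxE mulr_suml; apply: eq_bigr => p _; rewrite [_^T _ _]mxE; ring.
Qed.

(** The kinetic energy is differentiated with respect to the base point, for a
    vector [z] with constant coordinates in the chart [i]. In the chart [j] the
    coordinates [z *m jac i j y] of this vector depend on [y], which produces the
    term with second derivatives of the transition map. *)
Lemma energy_base_derivative i j y (z Z : 'I_n -> R) (l : 'I_n) : overlap i j y ->
  (forall p, Z p = \sum_(a < n) z a * jac i j y a p) ->
  2^-1 * (\sum_(a < n) \sum_(b < n) pd l (fun y => metric g i y a b) y * z a * z b) =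
  (\sum_(p < n) (\sum_(a < n) z a * pd l (pd a (trans i j p)) y) *
     \sum_(q < n) metric g j (transition (atlas i) (atlas j) y) p q * Z q) +
  \sum_(r < n) jac i j y l r *
    (2^-1 * \sum_(p < n) \sum_(q < n)
       pd r (fun y => metric g j y p q) (transition (atlas i) (atlas j) y) * Z p * Z q).
Proof.
move=> oy ZE.
pose c (s : R) : 'rV[R]_n := y + s *: delta_mx 0 l.
have c0 : c 0 = y by rewrite /c scale0r addr0.
have dc a : is_derive (0 : R) 1 (fun s => c s 0 a) ((a == l)%:R).
  have -> : (fun s => c s 0 a) = (fun s => y 0 a + s * (a == l)%:R).
    by rewrite funeqE => s; rewrite !mxE eqxx.
  have := is_deriveD (is_derive_cst (y 0 a) (0 : R) 1)
     (is_derive_mul (is_derive_id (0 : R) 1) (is_derive_cst ((a == l)%:R : R) (0 : R) 1)).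
  by rewrite mul1r mulr0 addr0 add0r.
have sumd (F : 'I_n -> R) : \sum_(a < n) (a == l)%:R * F a = F l.
  rewrite (bigD1 l)//= eqxx mul1r big1 ?addr0// => a al.
  by rewrite (negbTE al) mul0r.
have dcurve U f : open U -> Ck_on 1 U f -> U y ->
    is_derive (0 : R) 1 (fun s => f (c s)) (pd l f y).
  move=> oU Cf Uy; have := @is_derive_curve R n U f c 0 _ oU Cf _ dc.
  by rewrite c0 sumd; apply.
pose tr (y : 'rV[R]_n) := transition (atlas i) (atlas j) y.
pose W p s := \sum_(a < n) z a * pd a (trans i j p) (c s).
have W0 p : W p 0 = Z p.
  by rewrite /W ZE; apply: eq_bigr => a _; rewrite c0 mxE.
have dW p : is_derive (0 : R) 1 (W p) (\sum_(a < n) z a * pd l (pd a (trans i j p)) y).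
  apply: is_derive_bigsum => a.
  have := is_derive_mul (is_derive_cst (z a) (0 : R) 1)
    (dcurve _ _ (@overlap_open i j) (@jac_C1 i j a p) oy).
  by rewrite mul0r add0r.
have dtr p q : is_derive (0 : R) 1 (fun s => metric g j (tr (c s)) p q)
    (\sum_(r < n) jac i j y l r * pd r (fun y => metric g j y p q) (tr y)).
  have := @is_derive_curve R n _ _ (fun s => tr (c s)) 0 (fun r => jac i j y l r)
     (@chart_open j) (@metric_C1 j p q).
  rewrite c0; apply; first exact: overlap_trans.
  move=> b; rewrite mxE.
  exact: dcurve (@overlap_open i j) (@trans_Ck 1 i j b) oy.
have d1 : is_derive (0 : R) 1
    (fun s => \sum_(a < n) \sum_(b < n) metric g i (c s) a b * (z a * z b))
    (\sum_(a < n) \sum_(b < n) pd l (fun y => metric g i y a b) y * (z a * z b)).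
  apply: is_derive_bigsum => a; apply: is_derive_bigsum => b.
  have := is_derive_mul (dcurve _ _ (@chart_open i) (@metric_C1 i a b) (overlap_cimg oy))
    (is_derive_cst (z a * z b) (0 : R) 1).
  by rewrite mulr0 addr0.
have d2 : is_derive (0 : R) 1
    (fun s => \sum_(p < n) \sum_(q < n) (W p s * W q s) * metric g j (tr (c s)) p q)
    (\sum_(p < n) \sum_(q < n)
      (((\sum_(a < n) z a * pd l (pd a (trans i j p)) y) * Z q +
        Z p * \sum_(a < n) z a * pd l (pd a (trans i j q)) y) * metric g j (tr y) p q +
      (Z p * Z q) * \sum_(r < n) jac i j y l r * pd r (fun y => metric g j y p q) (tr y))).
  apply: is_derive_bigsum => p; apply: is_derive_bigsum => q.
  have := is_derive_mul (is_derive_mul (dW p) (dW q)) (dtr p q).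
  by rewrite c0 !W0.
have E12 : \forall s \near 0,
    \sum_(a < n) \sum_(b < n) metric g i (c s) a b * (z a * z b) =
    \sum_(p < n) \sum_(q < n) (W p s * W q s) * metric g j (tr (c s)) p q.
  have co : {for 0, continuous c}.
    by rewrite /c; move=> s; apply: cvgD; [exact: cvg_cst|exact: scalel_continuous].
  have : \forall s \near 0, overlap i j (c s).
    by apply: co; rewrite c0; apply: open_nbhs_nbhs; split=> //; exact: overlap_open.
  apply: filterS => s os.
  transitivity (\sum_(a < n) \sum_(b < n) \sum_(p < n) \sum_(q < n)
     z a * jac i j (c s) a p * (z b * jac i j (c s) b q) * metric g j (tr (c s)) p q).
    apply: eq_bigr => a _; apply: eq_bigr => b _.
    rewrite (metric_overlapE _ _ os) mulr_suml; apply: eq_bigr => p _.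
    by rewrite mulr_suml; apply: eq_bigr => q _; ring.
  symmetry; transitivity (\sum_(p < n) \sum_(q < n) \sum_(a < n) \sum_(b < n)
     z a * jac i j (c s) a p * (z b * jac i j (c s) b q) * metric g j (tr (c s)) p q).
    apply: eq_bigr => p _; apply: eq_bigr => q _; rewrite /W big_distrlr/= mulr_suml.
    apply: eq_bigr => a _; rewrite mulr_suml; apply: eq_bigr => b _.
    by rewrite !mxE.
  under eq_bigr do rewrite exchange_big/=; rewrite exchange_big/=.
  apply: eq_bigr => a _.
  under eq_bigr do rewrite exchange_big/=; rewrite exchange_big/=.
  by [].
have := near_eq_is_derive E12 d1 => d1'.
have E : \sum_(a < n) \sum_(b < n) pd l (fun y => metric g i y a b) y * (z a * z b) =
  \sum_(p < n) \sum_(q < n)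
      (((\sum_(a < n) z a * pd l (pd a (trans i j p)) y) * Z q +
        Z p * \sum_(a < n) z a * pd l (pd a (trans i j q)) y) * metric g j (tr y) p q +
      (Z p * Z q) * \sum_(r < n) jac i j y l r * pd r (fun y => metric g j y p q) (tr y)).
  by case: d1' => _ <-; case: d2 => _ <-.
have -> : \sum_(a < n) \sum_(b < n) pd l (fun y => metric g i y a b) y * z a * z b =
    \sum_(a < n) \sum_(b < n) pd l (fun y => metric g i y a b) y * (z a * z b).
  by apply: eq_bigr => a _; apply: eq_bigr => b _; rewrite mulrA.
rewrite {}E.
set w := fun p => \sum_(a < n) z a * pd l (pd a (trans i j p)) y.
have oty := overlap_trans oy.
have S1 : \sum_(p < n) \sum_(q < n) w p * Z q * metric g j (tr y) p q =
    \sum_(p < n) w p * \sum_(q < n) metric g j (tr y) p q * Z q.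
  apply: eq_bigr => p _; rewrite mulr_sumr; apply: eq_bigr => q _; ring.
have S2 : \sum_(p < n) \sum_(q < n) Z p * w q * metric g j (tr y) p q =
    \sum_(p < n) w p * \sum_(q < n) metric g j (tr y) p q * Z q.
  rewrite exchange_big; apply: eq_bigr => p _; rewrite mulr_sumr; apply: eq_bigr => q _.
  by rewrite -{1}(Defs.metric_sym g oty) mxE; ring.
have S3 : \sum_(p < n) \sum_(q < n) (Z p * Z q) *
      (\sum_(r < n) jac i j y l r * pd r (fun y => metric g j y p q) (tr y)) =
    \sum_(r < n) jac i j y l r *
    (\sum_(p < n) \sum_(q < n) pd r (fun y => metric g j y p q) (tr y) * Z p * Z q).
  transitivity (\sum_(p < n) \sum_(q < n) \sum_(r < n)
     jac i j y l r * (pd r (fun y => metric g j y p q) (tr y) * Z p * Z q)).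
    apply: eq_bigr => p _; apply: eq_bigr => q _; rewrite mulr_sumr.
    by apply: eq_bigr => r _; ring.
  under eq_bigr do rewrite exchange_big/=; rewrite exchange_big/=.
  apply: eq_bigr => r _; rewrite mulr_sumr; apply: eq_bigr => p _.
  by rewrite mulr_sumr.
transitivity (2^-1 * ((\sum_(p < n) \sum_(q < n) w p * Z q * metric g j (tr y) p q +
   \sum_(p < n) \sum_(q < n) Z p * w q * metric g j (tr y) p q) +
   \sum_(p < n) \sum_(q < n) (Z p * Z q) *
      (\sum_(r < n) jac i j y l r * pd r (fun y => metric g j y p q) (tr y)))).
  congr (_ * _); rewrite -!big_split/=; apply: eq_bigr => p _.
  by rewrite -!big_split/=; apply: eq_bigr => q _; rewrite mulrDl.
rewrite S1 S2 S3 mulrDr; congr (_ + _); first by lra.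
by rewrite mulr_sumr; apply: eq_bigr => r _; rewrite mulrCA.
Qed.

End ChartChange.

(** * Chart independence of geodesics, constancy of the energy *)

Section GeodesicEquation.
Context {R : realType} {n : nat} {X : topologicalType}.
Context {M : smooth_manifold R n X} (g : riemannian_metric M).
Implicit Types (i j : idx M) (gamma : R -> X) (t s : R).

Lemma is_derive_chart_coord i gamma t k : derivable (chart_coord i gamma k) t 1 ->
  is_derive t 1 (chart_coord i gamma k) (velocity i gamma k t).
Proof. by move=> d; rewrite /velocity derive1E; exact: derivableP. Qed.

Lemma velocity_change i j gamma t :
  cdom (atlas i) (gamma t) -> cdom (atlas j) (gamma t) ->
  {for t, continuous gamma} -> (forall k, derivable (chart_coord i gamma k) t 1) ->
  forall b, is_derive t 1 (chart_coord j gamma b)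
    (\sum_(a < n) velocity i gamma a t * jac i j (cmap (atlas i) (gamma t)) a b).
Proof.
move=> it jt ct dc b.
have oy : overlap i j (cmap (atlas i) (gamma t)) by exists (gamma t).
have := @is_derive_curve R n _ _ (fun s => cmap (atlas i) (gamma s)) t
  (fun a => velocity i gamma a t) (@overlap_open _ _ _ _ i j) (@trans_Ck _ _ _ _ 1 i j b) oy
  (fun a => is_derive_chart_coord (dc a)).
have -> : \sum_(a < n) velocity i gamma a t * pd a (trans i j b) (cmap (atlas i) (gamma t)) =
    \sum_(a < n) velocity i gamma a t * jac i j (cmap (atlas i) (gamma t)) a b.
  by apply: eq_bigr => a _; rewrite mxE.
apply: near_eq_is_derive; have := near_cdom it ct.
by apply: filterS => s is_; exact: transE.
Qed.

(** The momenta [P] (in the chart [i]) and [Q] (in the chart [j]) satisfy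
    [P = Q *m J^T] along the curve. Differentiating, the terms containing second
    derivatives of the transition map cancel against those produced by
    [energy_base_derivative], because mixed partial derivatives commute. *)
Lemma geodesic_at_change i j gamma (V : set R) t : open V -> V t ->
  (forall s, V s -> [/\ cdom (atlas i) (gamma s), cdom (atlas j) (gamma s) &
     {for s, continuous gamma}]) ->
  (forall s, V s -> forall k, derivable (chart_coord i gamma k) s 1) ->
  geodesic_at g i gamma t -> geodesic_at g j gamma t.
Proof.
move=> oV Vt HV dcV gi.
have [it jt ct] := HV _ Vt.
have dc k : derivable (chart_coord i gamma k) t 1 by case: (gi k).
have dv k : derivable (velocity i gamma k) t 1 by case: (gi k).
have near_V : \forall s \near t, V s by apply: open_nbhs_nbhs.
set c := fun s => cmap (atlas i) (gamma s).
have oy : overlap i j (c t) by exists (gamma t).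
have vj b s : V s -> velocity j gamma b s = \sum_(a < n) velocity i gamma a s * jac i j (c s) a b.
  move=> Vs; have [is_ js cs] := HV _ Vs.
  rewrite /velocity derive1E.
  by have [_ ->] := velocity_change is_ js cs (dcV _ Vs) b.
have dcj b : derivable (chart_coord j gamma b) t 1.
  by have [] := velocity_change it jt ct dc b.
have djac a b : is_derive t 1 (fun s => jac i j (c s) a b)
    (\sum_(e < n) velocity i gamma e t * pd e (pd a (trans i j b)) (c t)).
  have := @is_derive_curve R n _ _ c t (fun e => velocity i gamma e t)
    (@overlap_open _ _ _ _ i j) (@jac_C1 _ _ _ _ i j a b) oy
    (fun e => is_derive_chart_coord (dc e)).
  by apply: is_derive_ext => s; rewrite mxE.
have dvj b : derivable (velocity j gamma b) t 1.
  have H : is_derive t 1 (fun s => \sum_(a < n) velocity i gamma a s * jac i j (c s) a b)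
      (\sum_(a < n) ('D_1 (velocity i gamma a) t * jac i j (c t) a b +
         velocity i gamma a t *
         (\sum_(e < n) velocity i gamma e t * pd e (pd a (trans i j b)) (c t)))).
    apply: is_derive_bigsum => a; apply: is_derive_mul => //.
  have [+ _] := H; apply: near_eq_derivable.
  by apply: filterS near_V => s Vs; rewrite vj.
have geqi := (geodesic_eqP g it dc dv).1 (fun k => let: And3 _ _ e := gi k in e).
suff geqj : forall k, ((velocity j gamma k)^`())%classic t +
      \sum_(a < n) \sum_(b < n) christoffel g j (cmap (atlas j) (gamma t)) a b k *
        velocity j gamma a t * velocity j gamma b t = 0.
  by move=> k; split.
apply/(geodesic_eqP g jt dcj dvj).
pose Q b s := \sum_(k < n) metric g j (cmap (atlas j) (gamma s)) b k * velocity j gamma k s.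
pose P l s := \sum_(k < n) metric g i (c s) l k * velocity i gamma k s.
pose L b := 2^-1 * \sum_(p < n) \sum_(q < n)
  pd b (fun y => metric g j y p q) (cmap (atlas j) (gamma t)) *
  velocity j gamma p t * velocity j gamma q t.
have dQ b : is_derive t 1 (Q b) ('D_1 (Q b) t).
  apply: derivableP.
  have [] : is_derive t 1 (Q b) (\sum_(k < n)
     ((\sum_(e < n) velocity j gamma e t *
        pd e (fun y => metric g j y b k) (cmap (atlas j) (gamma t))) * velocity j gamma k t +
      metric g j (cmap (atlas j) (gamma t)) b k * 'D_1 (velocity j gamma k) t)) => //.
  apply: is_derive_bigsum => k; apply: is_derive_mul.
    have := @is_derive_curve R n _ _ (fun s => cmap (atlas j) (gamma s)) t
      (fun e => velocity j gamma e t) (@chart_open _ _ _ _ j) (@metric_C1 _ _ _ _ g j b k)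
      (cimg_cmap jt).
    by apply=> e; exact: is_derive_chart_coord.
  by apply: derivableP; exact: dvj.
have PQ l s : V s -> P l s = \sum_(b < n) jac i j (c s) l b * Q b s.
  move=> Vs; have [is_ js _] := HV _ Vs.
  have os : overlap i j (c s) by exists (gamma s).
  have tE : transition (atlas i) (atlas j) (c s) = cmap (atlas j) (gamma s).
    by rewrite /transition/= /c cmapK.
  rewrite /P /Q; transitivity (\sum_(k < n) \sum_(b < n) \sum_(q < n)
     jac i j (c s) l b * (metric g j (cmap (atlas j) (gamma s)) b q *
       (velocity i gamma k s * jac i j (c s) k q))).
    apply: eq_bigr => k _; rewrite (metric_overlapE g l k os) tE mulr_suml.
    apply: eq_bigr => b _; rewrite mulr_suml; apply: eq_bigr => q _; ring.
  rewrite exchange_big; apply: eq_bigr => b _; rewrite exchange_big mulr_sumr.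
  by apply: eq_bigr => q _; rewrite vj// !mulr_sumr.
have H l : \sum_(b < n) jac i j (c t) l b * ('D_1 (Q b) t - L b) = 0.
  have d1 : is_derive t 1 (fun s => \sum_(b < n) jac i j (c s) l b * Q b s)
     (\sum_(b < n) ((\sum_(e < n) velocity i gamma e t * pd e (pd l (trans i j b)) (c t)) * Q b t
        + jac i j (c t) l b * 'D_1 (Q b) t)).
    by apply: is_derive_bigsum => b; apply: is_derive_mul.
  have d2 : is_derive t 1 (fun s => \sum_(b < n) jac i j (c s) l b * Q b s)
      (2^-1 * \sum_(a < n) \sum_(b < n) pd l (fun y => metric g i y a b) (c t) *
        velocity i gamma a t * velocity i gamma b t).
    have := geqi l; apply: near_eq_is_derive.
    by apply: filterS near_V => s Vs; rewrite -PQ.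
  have E : 2^-1 * (\sum_(a < n) \sum_(b < n) pd l (fun y => metric g i y a b) (c t) *
        velocity i gamma a t * velocity i gamma b t) =
     \sum_(b < n) ((\sum_(e < n) velocity i gamma e t * pd e (pd l (trans i j b)) (c t)) * Q b t
        + jac i j (c t) l b * 'D_1 (Q b) t).
    by case: d2 => _ <-; case: d1 => _ <-.
  have tE : transition (atlas i) (atlas j) (c t) = cmap (atlas j) (gamma t).
    by rewrite /transition/= /c cmapK.
  move: E; rewrite (energy_base_derivative g l oy (fun p => vj p t Vt)) tE.
  rewrite -/(L _) [in RHS]big_split/= => E.
  under eq_bigr do rewrite mulrBr; rewrite sumrB.
  suff E2 : \sum_(p < n)
       (\sum_(a < n) velocity i gamma a t * pd l (pd a (trans i j p)) (c t)) * Q p t =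
     \sum_(b < n) (\sum_(e < n) velocity i gamma e t * pd e (pd l (trans i j b)) (c t)) * Q b t.
    have cancel (u v w x : R) : u + v = w + x -> u = w -> x - v = 0.
      by move=> e1 e2; move: e1; rewrite e2 => /addrI ->; rewrite subrr.
    exact: cancel E E2.
  have mixed p a : pd l (pd a (trans i j p)) (c t) = pd a (pd l (trans i j p)) (c t).
    exact: pd_comm (@overlap_open _ _ _ _ i j) (@trans_Ck _ _ _ _ 2 i j p) oy.
  have sum_mixed p :
      \sum_(a < n) velocity i gamma a t * pd l (pd a (trans i j p)) (c t) =
      \sum_(e < n) velocity i gamma e t * pd e (pd l (trans i j p)) (c t).
    by apply: eq_bigr => a _; rewrite mixed.
  exact: (eq_bigr _ (fun p _ => congr1 (fun u => u * Q p t) (sum_mixed p))).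
move=> b.
pose w : 'cV[R]_n := \col_b ('D_1 (Q b) t - L b).
have w0 : w = 0.
  rewrite -(mulKmx (jac_unit g oy) w) (_ : jac i j (c t) *m w = 0) ?mulmx0//.
  by apply/matrixP => l m; rewrite !mxE -[RHS](H l); apply: eq_bigr => k _; rewrite !mxE.
have : w b 0 = 0 by rewrite w0 mxE.
rewrite mxE => /eqP; rewrite subr_eq0 => /eqP E.
by rewrite -[X in is_derive _ _ _ X]/(L b) -E; exact: dQ.
Qed.

(** Square of the speed. *)
Definition energy i gamma s : R := \sum_(a < n) \sum_(b < n)
  metric g i (cmap (atlas i) (gamma s)) a b * velocity i gamma a s * velocity i gamma b s.

Lemma energy_change i j gamma t :
  cdom (atlas i) (gamma t) -> cdom (atlas j) (gamma t) ->
  {for t, continuous gamma} -> (forall k, derivable (chart_coord i gamma k) t 1) ->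
  energy i gamma t = energy j gamma t.
Proof.
move=> it jt ct dc; have oy : overlap i j (cmap (atlas i) (gamma t)) by exists (gamma t).
set J := jac i j (cmap (atlas i) (gamma t)).
have vj b : velocity j gamma b t = \sum_(a < n) velocity i gamma a t * J a b.
  by rewrite {1}/velocity derive1E; have [_ ->] := velocity_change it jt ct dc b.
have E k : energy k gamma t = ((\row_a velocity k gamma a t) *m
    metric g k (cmap (atlas k) (gamma t)) *m (\row_a velocity k gamma a t)^T) 0 0.
  by rewrite formE /energy; apply: eq_bigr => a _; apply: eq_bigr => b _; rewrite !mxE.
rewrite !E (metric_overlap g oy) /transition/= cmapK// -/J.
have -> : \row_a velocity j gamma a t = (\row_a velocity i gamma a t) *m J.
  apply/rowP => b; rewrite [LHS]mxE [RHS]mxE vj; apply: eq_bigr => a _.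
  by rewrite [X in _ = X * _]mxE.
by rewrite trmx_mul !mulmxA.
Qed.

(** Contracting the Euler-Lagrange equation with the velocity [z] gives
    [acc g z^T = - S / 2], where [S] is the derivative of the metric along [z],
    applied to [z] and [z]; the derivative of the energy is [2 acc g z^T + S]. *)
Lemma energy_derivative i gamma t : cdom (atlas i) (gamma t) ->
  geodesic_at g i gamma t -> is_derive t 1 (energy i gamma) 0.
Proof.
move=> it gi.
have dc k : derivable (chart_coord i gamma k) t 1 by case: (gi k).
have dv k : derivable (velocity i gamma k) t 1 by case: (gi k).
have geqi := (geodesic_eqP g it dc dv).1 (fun k => let: And3 _ _ e := gi k in e).
pose z k := velocity i gamma k t; pose acc k := 'D_1 (velocity i gamma k) t.
set c := fun s => cmap (atlas i) (gamma s) in geqi.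
pose P l s := \sum_(k < n) metric g i (c s) l k * velocity i gamma k s.
pose S := \sum_(l < n)
  (\sum_(a < n) \sum_(b < n) pd l (fun y => metric g i y a b) (c t) * z a * z b) * z l.
have dE : is_derive t 1 (fun s => \sum_(l < n) P l s * velocity i gamma l s)
   (\sum_(l < n) ((2^-1 * \sum_(a < n) \sum_(b < n)
      pd l (fun y => metric g i y a b) (c t) * z a * z b) * z l + P l t * acc l)).
  apply: is_derive_bigsum => l; exact: is_derive_mul (geqi l) (derivableP (dv l)).
have dP l : is_derive t 1 (P l) (\sum_(k < n) ((\sum_(e < n) z e *
    pd e (fun y => metric g i y l k) (c t)) * z k + metric g i (c t) l k * acc k)).
  apply: is_derive_bigsum => k; apply: is_derive_mul.
    have := @is_derive_curve R n _ _ c t z (@chart_open _ _ _ _ i)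
      (@metric_C1 _ _ _ _ g i l k) (cimg_cmap it).
    by apply=> a; exact: is_derive_chart_coord.
  by apply: derivableP; exact: dv.
have EL l : \sum_(k < n) ((\sum_(e < n) z e *
    pd e (fun y => metric g i y l k) (c t)) * z k + metric g i (c t) l k * acc k) =
    2^-1 * \sum_(a < n) \sum_(b < n) pd l (fun y => metric g i y a b) (c t) * z a * z b.
  by case: (dP l) => _ <-; case: (geqi l) => _ <-.
have half : S + \sum_(l < n) P l t * acc l = 2^-1 * S.
  transitivity (\sum_(l < n) z l * \sum_(k < n) ((\sum_(e < n) z e *
    pd e (fun y => metric g i y l k) (c t)) * z k + metric g i (c t) l k * acc k)).
    under [RHS]eq_bigr do rewrite big_split mulrDr/=.
    rewrite big_split/=; congr (_ + _).
      rewrite /S; under [RHS]eq_bigr do rewrite mulr_sumr.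
      under [RHS]eq_bigr do under eq_bigr do rewrite mulr_suml mulr_sumr.
      under [RHS]eq_bigr do rewrite exchange_big/=.
      rewrite [RHS]exchange_big; apply: eq_bigr => e _; rewrite mulr_suml.
      apply: eq_bigr => a _; rewrite mulr_suml; apply: eq_bigr => b _; ring.
    rewrite /P; under eq_bigr do rewrite mulr_suml.
    rewrite exchange_big; apply: eq_bigr => l _; rewrite mulr_sumr.
    apply: eq_bigr => k _; have := cimg_cmap it => /(Defs.metric_sym g) sG.
    by rewrite -/(c t) in sG; rewrite -{1}sG mxE /z; ring.
  rewrite /S mulr_sumr; apply: eq_bigr => l _; rewrite EL; ring.
have d0 : \sum_(l < n) ((2^-1 * \sum_(a < n) \sum_(b < n)
      pd l (fun y => metric g i y a b) (c t) * z a * z b) * z l + P l t * acc l) = 0.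
  rewrite big_split/=.
  have -> : \sum_(l < n) (2^-1 * \sum_(a < n) \sum_(b < n)
      pd l (fun y => metric g i y a b) (c t) * z a * z b) * z l = 2^-1 * S.
    by rewrite /S mulr_sumr; apply: eq_bigr => l _; rewrite mulrA.
  move: half; move: S (\sum_(l < n) P l t * acc l) => u v h; lra.
rewrite -d0; apply: is_derive_ext dE => s.
apply: eq_bigr => l _; rewrite /P mulr_suml; apply: eq_bigr => k _.
by rewrite mulrAC.
Qed.

Lemma is_derive0_cst_itv (f : R -> R) (J : set R) : is_interval J ->
  (forall t, J t -> is_derive t 1 f 0) -> forall s t, J s -> J t -> f s = f t.
Proof.
move=> iJ df.
suff H s t : J s -> J t -> s < t -> f s = f t.
  move=> s t Js Jt; have [st|ts|->//] := ltgtP s t; first exact: H.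
  by symmetry; exact: H.
move=> Js Jt st; have [||x _ E] := @MVT_closed R f (fun=> 0) s t => //.
  by move=> x sxt; apply: df; exact: iJ Js Jt _ sxt.
by move: E; rewrite mul0r => /eqP; rewrite subr_eq0 => /eqP.
Qed.

(** The preferred chart changes along the curve, but the energy does not depend on
    the chart and can be computed in a single one near each time. *)
Lemma energy_cst (J : set R) gamma : open J -> is_interval J -> geodesic_on g J gamma ->
  forall s t, J s -> J t ->
  energy (idx_at M (gamma s)) gamma s = energy (idx_at M (gamma t)) gamma t.
Proof.
move=> oJ iJ geo.
apply: (@is_derive0_cst_itv (fun s => energy (idx_at M (gamma s)) gamma s) J iJ) => t Jt.
have [ct gt] := geo _ Jt; set i := idx_at M (gamma t).
have it : cdom (atlas i) (gamma t) by exact: mem_chart_at.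
have := energy_derivative it (gt i it); apply: near_eq_is_derive.
have near_J : \forall s \near t, J s by apply: open_nbhs_nbhs.
apply: filterS2 near_J (near_cdom it ct) => s Js is_.
have [cs gs] := geo _ Js.
apply: energy_change => //; first exact: mem_chart_at.
by move=> k; have [d _ _] := gs i is_ k; exact: d.
Qed.

End GeodesicEquation.

(** * Limits and primitives on the real line *)

Section RealAnalysis.
Context {R : realType}.
Implicit Types (f g : R -> R) (s t : R).

Lemma near_realP t (P : set R) :
  (\forall s \near t, P s) <-> exists2 r : R, 0 < r & forall s, `|s - t| < r -> P s.
Proof.
split=> [/nbhs_ballP[r r0 H]|[r r0 H]].
  by exists r => // s sr; apply: H; rewrite -ball_normE/= distrC.
by apply/nbhs_ballP; exists r => // s; rewrite -ball_normE/= distrC; exact: H.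
Qed.

Lemma separating_real (P Q : set R) : P !=set0 -> Q !=set0 ->
  (forall p q, P p -> Q q -> p <= q) ->
  exists l, (forall p, P p -> p <= l) /\ (forall q, Q q -> l <= q).
Proof.
move=> P0 [q0 Qq0] H; exists (sup P); split.
  move=> p Pp; apply: ub_le_sup => //; exists q0 => p' Pp'; exact: H.
by move=> q Qq; apply: ge_sup => // p Pp; exact: H.
Qed.

Lemma derive_bound_lipschitz f df (I : set R) (K : R) : is_interval I ->
  (forall x, I x -> is_derive x 1 f (df x)) -> (forall x, I x -> `|df x| <= K) ->
  forall s t, I s -> I t -> `|f s - f t| <= K * `|s - t|.
Proof.
move=> iI d bd.
suff H s t : I s -> I t -> s < t -> `|f s - f t| <= K * `|s - t|.
  move=> s t Is It; have [st|ts|->] := ltgtP s t; first exact: H.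
    by rewrite distrC [`|s - t|]distrC; exact: H.
  by rewrite !subrr normr0 mulr0.
move=> Is It st; have [||x xst E] := @MVT_closed R f df s t => //.
  by move=> x sxt; apply: d; exact: iI Is It _ sxt.
rewrite distrC E normrM [`|s - t|]distrC ler_wpM2r//; apply: bd.
by apply: iI Is It _ _; case/andP: xst => sx xt; rewrite !ltW.
Qed.

Lemma half_pow_small (D e : R) : 0 < e -> exists k : nat, D / 2 ^+ k <= e.
Proof.
move=> e0; pose k := Num.truncn (`|D| / e); exists k.+1.
have k1 : `|D| / e < k.+1%:R.
  by apply: truncnS_gt.
have k2 : (k.+1%:R : R) <= 2 ^+ k.+1.
  by rewrite -natrX ler_nat ltnW// ltn_expl.
rewrite ler_pdivrMr ?exprn_gt0// mulrC -ler_pdivrMr//.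
apply: le_trans k2; apply: le_trans (ltW k1).
by rewrite ler_pM2r ?invr_gt0// ler_norm.
Qed.

Lemma le_all_half_pow (x D : R) : (forall k : nat, x <= D / 2 ^+ k) -> x <= 0.
Proof.
move=> H; apply/ler_addgt0Pl => e e0; rewrite addr0.
by have [k] := half_pow_small D e0; apply: le_trans.
Qed.

(** The limit separates the increasing sequence of lower bounds
    [u k - 2 D / 2^k] from the decreasing sequence of upper bounds
    [u k + 2 D / 2^k]. *)
Lemma geometric_limit (u : nat -> R) (D : R) :
  (forall k, `|u k.+1 - u k| <= D / 2 ^+ k) ->
  exists l, forall k, `|u k - l| <= 2 * D / 2 ^+ k.
Proof.
move=> H; pose v k := u k - 2 * D / 2 ^+ k; pose w k := u k + 2 * D / 2 ^+ k.
have half k : 2 * D / 2 ^+ k.+1 = D / 2 ^+ k.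
  by rewrite exprS invfM mulrACA divff ?mul1r// pnatr_eq0.
have dbl k : 2 * D / 2 ^+ k = D / 2 ^+ k + D / 2 ^+ k.
  by rewrite -mulrA mulr_natl mulr2n.
have vS k : v k <= v k.+1.
  rewrite /v half dbl; have := H k; rewrite ler_norml => /andP[h1 h2].
  move: h1 h2; move: (D / _) (u k) (u k.+1) => a b c; lra.
have wS k : w k.+1 <= w k.
  rewrite /w half dbl; have := H k; rewrite ler_norml => /andP[h1 h2].
  move: h1 h2; move: (D / _) (u k) (u k.+1) => a b c; lra.
have vm : {homo v : a b / (a <= b)%N >-> a <= b} := homo_leq (@lexx _ _) (@le_trans _ _) vS.
have wm : {homo w : a b / (a <= b)%N >-> b <= a}.
  by apply: (@homo_leq _ w (fun a b => b <= a)) => // a b c ba cb; exact: le_trans cb ba.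
have vw k : v k <= w k.
  have := le_trans (normr_ge0 _) (H k).
  by rewrite /v /w dbl; move: (D / _) (u k) => a b h; lra.
have [|||l [lv lw]] := @separating_real (range v) (range w).
- by exists (v 0%N), 0%N.
- by exists (w 0%N), 0%N.
- move=> _ _ [a _ <-] [b _ <-]; apply: le_trans (vm a (maxn a b) (leq_maxl _ _)) _.
  exact: le_trans (vw _) (wm b (maxn a b) (leq_maxr _ _)).
exists l => k; rewrite ler_norml.
have h1 : v k <= l by apply: lv; exists k.
have h2 : l <= w k by apply: lw; exists k.
by move: h1 h2; rewrite /v /w; move: (2 * D / _) (u k) => a b *; apply/andP; split; lra.
Qed.

Lemma lipschitz_left_limit f (a b K : R) : a < b ->
  (forall s t, a < s < b -> a < t < b -> `|f s - f t| <= K * `|s - t|) ->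
  exists l, forall t, a < t < b -> `|f t - l| <= K * (b - t).
Proof.
move=> ab H.
pose m := (a + b) / 2; have mab : a < m < b by rewrite /m; apply/andP; split; lra.
have [|||l [lv lw]] := @separating_real
   [set f t - K * (b - t) | t in [set t | a < t < b]]
   [set f t + K * (b - t) | t in [set t | a < t < b]].
- by exists (f m - K * (b - m)), m.
- by exists (f m + K * (b - m)), m.
- move=> _ _ [s sab <-] [t tab <-]; have := H s t sab tab.
  rewrite ler_norml => /andP[h1 h2].
  have K0 : 0 <= K.
    have {h1 h2} := H ((m + b) / 2) m; case/andP: mab => am mb.
    have -> : a < (m + b) / 2 < b by apply/andP; split; lra.
    rewrite am mb => /(_ isT isT) /(le_trans (normr_ge0 _)).
    by rewrite pmulr_lge0// normr_gt0; apply/eqP => h; lra.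
  have : K * `|s - t| <= K * (b - s) + K * (b - t).
    rewrite -mulrDr ler_wpM2l// ler_norml; case/andP: sab => ? ?; case/andP: tab => ? ?.
    by apply/andP; split; lra.
  move: h1 h2; move: (K * `|_|) (K * (b - s)) (K * (b - t)) (f s) (f t) => *; lra.
exists l => t tab; rewrite ler_norml.
have h1 : f t - K * (b - t) <= l by apply: lv; exists t.
have h2 : l <= f t + K * (b - t) by apply: lw; exists t.
by move: h1 h2; move: (K * _) (f t) => *; apply/andP; split; lra.
Qed.

(** The radius 2 leaves room around the time intervals of radius at most 1 that
    occur in Picard iteration. *)
Lemma primitive_exists f T : continuous f ->
  exists G : R -> R, G T = 0 /\ forall t, `|t - T| < 2 -> is_derive t 1 G (f t).
Proof.
move=> cf; pose G0 x := (\int[@lebesgue_measure R]_(t in `[(T - 2), x]) f t)%R.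
exists (fun x => G0 x - G0 T); split; first by rewrite subrr.
move=> t; rewrite ltr_norml => /andP[h1 h2].
have [||||d1 d2] := @continuous_FTC1_closed R f (T - 2) t (T + 2).
- lra.
- by apply: continuous_compact_integrable; [exact: segment_compact|
     exact: continuous_subspaceT].
- lra.
- exact: cf.
have dG0 : is_derive t 1 G0 (f t) by apply: DeriveDef; [exact: d1|rewrite -derive1E; exact: d2].
have := is_deriveB dG0 (is_derive_cst (G0 T) t 1); rewrite subr0.
by apply: is_derive_ext.
Qed.

End RealAnalysis.

(** * Local existence for ordinary differential equations *)

Section Picard.
Context {R : realType} {m : nat}.
Implicit Types (F : 'rV[R]_m -> 'rV[R]_m) (x y z : 'rV[R]_m).

(** Retraction of the line onto the segment with center [c] and radius [e]. *)
Definition clamp (c e u : R) := Num.max (c - e) (Num.min (c + e) u).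

Lemma clamp_in c e u : 0 <= e -> `|clamp c e u - c| <= e.
Proof.
move=> e0; rewrite /clamp ler_norml.
by case: (leP (c + e) u) => h1; case: (leP (c - e) _) => h2; apply/andP; split; lra.
Qed.

Lemma clamp_id c e u : `|u - c| <= e -> clamp c e u = u.
Proof.
rewrite /clamp ler_norml => /andP[h1 h2].
by case: (leP (c + e) u) => h3; case: (leP (c - e) _) => h4; lra.
Qed.

Lemma clamp_lipschitz c e u v : 0 <= e -> `|clamp c e u - clamp c e v| <= `|u - v|.
Proof.
move=> e0; suff H a b : a <= b -> 0 <= clamp c e b - clamp c e a <= b - a.
  have [uv|vu] := leP u v.
    have /andP[h1 h2] := H _ _ uv.
    by rewrite distrC [`|u - v|]distrC ger0_norm// (le_trans h2)// ler_norm.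
  have /andP[h1 h2] := H _ _ (ltW vu).
  by rewrite ger0_norm// (le_trans h2)// ler_norm.
rewrite /clamp => ab.
by case: (leP (c + e) a) => h1; case: (leP (c + e) b) => h2;
  do ?[case: (leP (c - e) _) => ?]; apply/andP; split; lra.
Qed.

Lemma loc_lipschitz_row F x : (forall a, loc_lipschitz x (fun y => F y 0 a)) ->
  exists C r : R, [/\ 0 <= C, 0 < r &
    forall y z, `|y - x| < r -> `|z - x| < r -> `|F y - F z| <= C * `|y - z|].
Proof.
move=> /choice[C /choice[r H]].
exists (\sum_(a < m) C a), (\big[Num.min/1]_(a < m) r a).
have C0 a : 0 <= C a by case: (H a).
split; first exact: sumr_ge0.
  by apply/bigmin_gtP; split=> // a _; case: (H a).
move=> y z /bigmin_gtP[_ yr] /bigmin_gtP[_ zr].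
apply: norm_le_coord; first by rewrite mulr_ge0// sumr_ge0.
move=> a; rewrite !mxE; case: (H a) => _ _ /(_ y z (yr a isT) (zr a isT)).
move=> /le_trans; apply; rewrite ler_wpM2r// (bigD1 a)//= lerDl.
exact: sumr_ge0.
Qed.

(** Picard-Lindelof for a globally Lipschitz and bounded field, on a time
    interval short enough for the integral operator to halve distances. *)
Lemma picard_global F (x0 : 'rV[R]_m) (C B e T : R) :
  0 <= C -> 0 <= B -> 0 < e -> e <= 1 -> 2 * (C * e) <= 1 ->
  (forall y z, `|F y - F z| <= C * `|y - z|) -> (forall y, `|F y| <= B) ->
  exists Y : R -> 'rV[R]_m, [/\ Y T = x0, forall t, `|Y t - x0| <= B * e &
    forall t, `|t - T| < e -> forall a, is_derive t 1 (fun s => Y s 0 a) (F (Y t) 0 a)].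
Proof.
move=> C0 B0 e0 e1 Ce LF BF; have e0' := ltW e0.
pose lip (Y : R -> 'rV[R]_m) := forall s t, `|Y s - Y t| <= B * `|s - t|.
have lip_cont Y a : lip Y -> continuous (fun s => F (Y s) 0 a).
  move=> LY t; apply/cvgrPdist_le => d d0.
  have K0 : 0 < C * B + 1 by rewrite ltr_wpDl// mulr_ge0.
  apply/near_realP; exists (d / (C * B + 1)); first exact: divr_gt0.
  move=> s; rewrite ltr_pdivlMr// distrC => /ltW; apply: le_trans.
  have := coord_le_norm (F (Y t) - F (Y s)) a; rewrite !mxE => /le_trans; apply.
  apply: le_trans (LF _ _) _; apply: (@le_trans _ _ (C * (B * `|t - s|))).
    by rewrite ler_wpM2l.
  by rewrite mulrA mulrDr mulr1 mulrC lerDl.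
have /choice[prim primP] : forall f : R -> R, exists G : R -> R, continuous f ->
    G T = 0 /\ forall t, `|t - T| < 2 -> is_derive t 1 G (f t).
  move=> f; have [cf|ncf] := pselect (continuous f); last by exists (fun=> 0).
  by have [G HG] := primitive_exists T cf; exists G.
pose I := [set t : R | `|t - T| <= e].
have iI : is_interval I.
  move=> s t; rewrite /I/= !ler_norml => /andP[? ?] /andP[? ?] u /andP[? ?].
  by rewrite ler_norml; apply/andP; split; lra.
have clampI t : I (clamp T e t) by exact: clamp_in.
have IT : I T by rewrite /I/= subrr normr0.
have I2 t : I t -> `|t - T| < 2.
  by rewrite /I/= => h; apply: le_lt_trans h _; lra.
(* With the time clamped to the segment, the iterates are [B]-Lipschitz on the
   whole line. *)
pose Phi (Y : R -> 'rV[R]_m) (t : R) : 'rV[R]_m :=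
  \row_a (x0 0 a + prim (fun s => F (Y s) 0 a) (clamp T e t)).
have dprim Y a : lip Y -> forall t, I t ->
    is_derive t 1 (prim (fun s => F (Y s) 0 a)) (F (Y t) 0 a).
  by move=> LY t /I2; exact: (primP _ (lip_cont Y a LY)).2.
have prim0 Y a : lip Y -> prim (fun s => F (Y s) 0 a) T = 0.
  by move=> LY; exact: (primP _ (lip_cont Y a LY)).1.
have coordF y a : `|F y 0 a| <= B := le_trans (coord_le_norm _ _) (BF _).
have Phi_lip Y : lip Y -> lip (Phi Y).
  move=> LY s t; apply: norm_le_coord; first by rewrite mulr_ge0.
  move=> a; rewrite !mxE opprD addrACA subrr add0r.
  apply: le_trans (derive_bound_lipschitz iI (dprim Y a LY) _ (clampI s) (clampI t)) _.
    by move=> u _; exact: coordF.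
  by rewrite ler_wpM2l// clamp_lipschitz.
have Phi_contract Y Z D : lip Y -> lip Z -> 0 <= D -> (forall s, `|Y s - Z s| <= D) ->
    forall s, `|Phi Y s - Phi Z s| <= D / 2.
  move=> LY LZ D0 YZ s; apply: norm_le_coord; first by rewrite divr_ge0.
  move=> a; rewrite !mxE opprD addrACA subrr add0r.
  have dd t : I t -> is_derive t 1
      (fun t => prim (fun s => F (Y s) 0 a) t - prim (fun s => F (Z s) 0 a) t)
      (F (Y t) 0 a - F (Z t) 0 a).
    by move=> It; exact: is_deriveB (dprim Y a LY t It) (dprim Z a LZ t It).
  have bd t : I t -> `|F (Y t) 0 a - F (Z t) 0 a| <= C * D.
    move=> _; have := coord_le_norm (F (Y t) - F (Z t)) a; rewrite !mxE.
    move=> /le_trans; apply; apply: le_trans (LF _ _) _; by rewrite ler_wpM2l.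
  have := derive_bound_lipschitz iI dd bd (clampI s) IT.
  rewrite !prim0// subrr subr0 => /le_trans; apply.
  apply: (@le_trans _ _ (C * D * e)).
    by rewrite ler_wpM2l ?mulr_ge0//; exact: clampI.
  have -> : C * D * e = D * (C * e) by ring.
  by rewrite ler_wpM2l//; lra.
pose Y k := iter k Phi (fun=> x0).
have LY k : lip (Y k).
  elim: k => [|k IH]; last exact: Phi_lip.
  by move=> s t; rewrite subrr normr0 mulr_ge0.
have Phi_near Z : lip Z -> forall t, `|Phi Z t - x0| <= B * e.
  move=> LZ t; apply: norm_le_coord; first by rewrite mulr_ge0.
  move=> a; rewrite !mxE [x0 0 a + _]addrC addrK.
  have := derive_bound_lipschitz iI (dprim Z a LZ) (fun u _ => coordF (Z u) a) (clampI t) IT.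
  rewrite prim0// subr0 => /le_trans; apply.
  by rewrite ler_wpM2l//; exact: clampI.
have Ystep k t : `|Y k.+1 t - Y k t| <= B * e / 2 ^+ k.
  elim: k t => [|k IH] t; first by rewrite expr0 divr1; exact: Phi_near (LY 0%N) t.
  rewrite exprSr invfM mulrA; apply: (Phi_contract _ _ _ (LY _) (LY _) _ IH).
  by rewrite divr_ge0 ?mulr_ge0// exprn_ge0.
have /choice[L HL] : forall t, exists l : 'rV[R]_m,
    forall k, `|Y k t - l| <= 2 * (B * e) / 2 ^+ k.
  move=> t; have /choice[l Hl] : forall a, exists l : R,
      forall k, `|Y k t 0 a - l| <= 2 * (B * e) / 2 ^+ k.
    move=> a; apply: geometric_limit => k; apply: le_trans (Ystep k t).
    by have := coord_le_norm (Y k.+1 t - Y k t) a; rewrite !mxE.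
  exists (\row_a l a) => k; apply: norm_le_coord.
    by rewrite divr_ge0 ?mulr_ge0// exprn_ge0.
  by move=> a; rewrite !mxE.
set D := 2 * (B * e) in HL.
have D0 : 0 <= D by rewrite /D !mulr_ge0.
have LL : lip L.
  move=> s t; rewrite -subr_le0; apply: (@le_all_half_pow _ _ (2 * D)) => k.
  have := LY k s t; have h1 := HL s k; have h2 := HL t k.
  have : `|L s - L t| <= `|L s - Y k s| + (`|Y k s - Y k t| + `|Y k t - L t|).
    apply: le_trans (ler_distD (Y k s) _ _) _; rewrite lerD2l; exact: ler_distD.
  rewrite [`|L s - Y k s|]distrC -mulrA mulr_natl mulr2n.
  move: h1 h2; move: (D / _) (`|_|) (`|_|) (`|_|) (`|_|) (B * _) => *; lra.
have fixL t : Phi L t = L t.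
  apply/eqP; rewrite -subr_eq0 -normr_le0; apply: (@le_all_half_pow _ _ D) => k.
  apply: le_trans (ler_distD (Y k.+1 t) _ _) _.
  have h1 : `|Phi L t - Y k.+1 t| <= D / 2 ^+ k / 2.
    apply: Phi_contract => //; first by rewrite divr_ge0// exprn_ge0.
    by move=> s; rewrite distrC.
  have h2 := HL t k.+1; rewrite exprSr invfM mulrA in h2.
  move: h1 h2; move: (D / _) (`|_|) (`|_|) => *; lra.
exists L; split.
- rewrite -fixL; apply/rowP => a; rewrite mxE clamp_id ?subrr ?normr0//.
  by rewrite prim0// addr0.
- by move=> t; rewrite -fixL; exact: Phi_near.
- move=> t te a.
  have : is_derive t 1 (fun s => x0 0 a + prim (fun s => F (L s) 0 a) s) (F (L t) 0 a).
    have := is_deriveD (is_derive_cst (x0 0 a) t 1) (dprim L a LL t (ltW te)).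
    by rewrite add0r.
  apply: near_eq_is_derive.
  have : \forall s \near t, `|s - T| < e.
    apply/near_realP; exists (e - `|t - T|); first by rewrite subr_gt0.
    by move=> s st; apply: le_lt_trans (ler_distD t _ _) _; lra.
  apply: filterS => s se; rewrite -[in RHS]fixL mxE clamp_id//; exact: ltW.
Qed.

(** Clamping the coordinates to a small ball turns the field into a globally
    Lipschitz and bounded one. For a short time the solution stays in the ball,
    where the two fields agree. *)
Lemma picard_local F (x0 : 'rV[R]_m) (T : R) :
  (forall a, loc_lipschitz x0 (fun y => F y 0 a)) ->
  exists e : R, 0 < e /\ exists Y : R -> 'rV[R]_m, Y T = x0 /\
    forall t, `|t - T| < e -> forall a, is_derive t 1 (fun s => Y s 0 a) (F (Y t) 0 a).
Proof.
move=> /loc_lipschitz_row[C [r [C0 r0 LF]]].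
pose rho := r / 2; have rho0 : 0 < rho by rewrite divr_gt0.
have rho0' := ltW rho0; have rho_r : rho < r by rewrite /rho; lra.
pose cl (y : 'rV[R]_m) : 'rV[R]_m := \row_a clamp (x0 0 a) rho (y 0 a).
have cl_in y : `|cl y - x0| < r.
  apply: le_lt_trans rho_r; apply: norm_le_coord => // a; rewrite !mxE; exact: clamp_in.
have cl_lip y z : `|cl y - cl z| <= `|y - z|.
  apply: norm_le_coord => // a; rewrite !mxE.
  apply: le_trans (clamp_lipschitz _ _ _ _) _ => //.
  by have := coord_le_norm (y - z) a; rewrite !mxE.
have cl_id y : `|y - x0| <= rho -> cl y = y.
  move=> yr; apply/rowP => a; rewrite !mxE clamp_id//; apply: le_trans yr.
  by have := coord_le_norm (y - x0) a; rewrite !mxE.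
pose B := `|F x0| + C * r.
have B0 : 0 <= B by rewrite addr_ge0// mulr_ge0// ltW.
have x0r : `|x0 - x0| < r by rewrite subrr normr0.
have BF y : `|F (cl y)| <= B.
  rewrite -[F (cl y)](subrK (F x0)) addrC (le_trans (ler_normD _ _))// lerD2l.
  by apply: le_trans (LF _ _ (cl_in _) x0r) _; rewrite ler_wpM2l// ltW.
(* The three terms of [K] correspond to the three bounds on [e = K^-1] below. *)
pose K := 1 + 2 * C + B / rho.
have K1 : 1 <= K by rewrite /K -addrA lerDl; apply: addr_ge0; [exact: mulr_ge0|exact: divr_ge0].
have K0 : 0 < K by lra.
pose e := K^-1.
have e0 : 0 < e by rewrite invr_gt0.
have e0' := ltW e0.
have Ke : K * e = 1 by rewrite divff// gt_eqF.
have [e1 e2 e3] : [/\ e <= 1, 2 * (C * e) <= 1 & B * e <= rho].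
  have Ce0 : 0 <= C * e by rewrite mulr_ge0.
  have Be0 : 0 <= B / rho * e by rewrite mulr_ge0// divr_ge0.
  have E : e + 2 * (C * e) + B / rho * e = K * e by rewrite /K; ring.
  rewrite Ke in E.
  split; [lra|lra|].
  have -> : B * e = B / rho * e * rho by field; rewrite gt_eqF.
  by rewrite -[leRHS]mul1r ler_wpM2r//; lra.
have [|Y [YT Yin dY]] := @picard_global (F \o cl) x0 C B e T C0 B0 e0 e1 e2 _ BF.
  move=> y z /=; apply: le_trans (LF _ _ (cl_in _) (cl_in _)) _.
  by rewrite ler_wpM2l.
exists e; split=> //; exists Y; split=> // t te a.
by have := dY t te a; rewrite /= cl_id// (le_trans (Yin t)).
Qed.

End Picard.

(** * Continuation of solutions past a limit point *)

Section OdeExtension.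
Context {R : realType}.

Lemma real_induction (P : set R) (a b : R) : P a ->
  (forall t, a <= t < b -> (forall s, a <= s <= t -> P s) ->
     exists2 d, 0 < d & forall s, t < s < t + d -> P s) ->
  (forall t, a < t <= b -> (forall s, a <= s < t -> P s) -> P t) ->
  forall t, a <= t <= b -> P t.
Proof.
move=> Pa Pright Pleft t /andP[at_ tb].
pose A := [set u | a <= u <= t /\ forall s, a <= s <= u -> P s].
have Aa : A a.
  split; first by rewrite lexx.
  by move=> s sa; rewrite (_ : s = a)//; apply/eqP; rewrite eq_sym eq_le.
have supA : has_sup A by split; [exists a|exists t => u [/andP[]]].
have asup : a <= sup A by apply: ub_le_sup => //; exact: supA.2.
have supt : sup A <= t by apply: ge_sup; [exists a|move=> u [/andP[]]].
have below s : a <= s < sup A -> P s.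
  move=> /andP[as_ ss].
  have ss0 : 0 < sup A - s by rewrite subr_gt0.
  have [u [_ Pu] su] := sup_adherent ss0 supA.
  by apply: Pu; rewrite as_ ltW//; move: su; rewrite subKr.
have Psup : P (sup A).
  have [->//|ne] := eqVneq (sup A) a.
  by apply: Pleft => //; rewrite lt_neqAle eq_sym ne asup (le_trans supt).
have upto s : a <= s <= sup A -> P s.
  move=> /andP[as_]; rewrite le_eqVlt => /predU1P[->//|ss]; apply: below.
  by rewrite as_.
have [E|ne] := eqVneq (sup A) t; first by rewrite -E.
have sup_lt : sup A < t by rewrite lt_neqAle ne.
have [|d d0 Pd] := Pright (sup A) _ upto; first by rewrite asup (lt_le_trans sup_lt).
pose u := Num.min t (sup A + d / 2).
have su : sup A < u by rewrite lt_min sup_lt/=; lra.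
suff Au : A u by have := ub_le_sup supA.2 Au; rewrite leNgt su.
split; first by rewrite (le_trans asup (ltW su)) ge_min lexx.
move=> s /andP[as_]; rewrite le_min => /andP[st sd].
have [ss|ss] := leP s (sup A); first by apply: upto; rewrite as_.
by apply: Pd; rewrite ss/=; lra.
Qed.

(** By the mean value theorem the difference quotients at [T] are values of the
    derivative at points tending to [T]. *)
Lemma removable_derivative (f df : R -> R) (T e : R) : 0 < e ->
  {for T, continuous f} -> {for T, continuous df} ->
  (forall t, `|t - T| < e -> t != T -> is_derive t 1 f (df t)) ->
  is_derive T 1 f (df T).
Proof.
move=> e0 cf cdf d; apply/is_derive_cvgP; apply/cvgrPdist_le => eps eps0.
have /cvgrPdist_le/(_ _ eps0)/near_realP[r r0 rP] := cdf.
have cont t : `|t - T| < e -> {for t, continuous f}.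
  by have [->//|tT] := eqVneq t T; move=> /d/(_ tT); exact: is_derive_continuous.
have mvt a b : `|a - T| < e -> `|b - T| < e -> a < b -> (b <= T) || (T <= a) ->
    exists2 c, a < c < b & f b - f a = df c * (b - a).
  move=> aT bT ab side; have [||c cab E] := @MVT R f df a b ab.
  - move=> x; rewrite in_itv/= => /andP[ax xb]; apply: d.
      by move: aT bT; rewrite !ltr_norml => /andP[? ?] /andP[? ?]; apply/andP; split; lra.
    by case/orP: side => h; rewrite ?(lt_eqF (lt_le_trans xb h)) ?(gt_eqF (le_lt_trans h ax)).
  - apply: continuous_in_subspaceT => x; rewrite inE/= in_itv/= => /andP[ax xb].
    apply: cont.
    by move: aT bT; rewrite !ltr_norml => /andP[? ?] /andP[? ?]; apply/andP; split; lra.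
  - by exists c => //; move: cab; rewrite in_itv.
rewrite /= ; near=> h.
have h0 : h != 0 by near: h; exact: nbhs_dnbhs_neq.
have he : `|h| < e by near: h; exact: dnbhs0_lt.
have hr : `|h| < r by near: h; exact: dnbhs0_lt.
have T0 : `|T - T| < e by rewrite subrr normr0.
have The : `|T + h - T| < e by rewrite addrAC subrr add0r.
have [hn|hp|h00] := ltgtP h 0; last by rewrite h00 eqxx in h0.
- have [||c /andP[c1 c2] E] := mvt (T + h) T The T0; [lra|by rewrite lexx|].
  have -> : h^-1 * (f (T + h) - f T) = df c.
    by rewrite -opprB E; field.
  apply: rP; move: hr; rewrite !ltr_norml => /andP[? ?]; apply/andP; split; lra.
- have [||c /andP[c1 c2] E] := mvt T (T + h) T0 The; [lra|by rewrite lexx orbT|].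
  have -> : h^-1 * (f (T + h) - f T) = df c by rewrite E; field.
  apply: rP; move: hr; rewrite !ltr_norml => /andP[? ?]; apply/andP; split; lra.
Unshelve. all: by end_near. Qed.

(** The solution with initial value the limit is glued to [Y] at [T], where the
    equation for the glued curve follows from [removable_derivative]. *)
Lemma ode_extend (m : nat) (F : 'rV[R]_m -> 'rV[R]_m) (Y : R -> 'rV[R]_m) y0 (t1 T K : R) :
  t1 < T -> (forall a, loc_lipschitz y0 (fun y => F y 0 a)) ->
  (forall t, t1 < t < T -> forall a, is_derive t 1 (fun s => Y s 0 a) (F (Y t) 0 a)) ->
  (forall t, t1 < t < T -> `|Y t - y0| <= K * (T - t)) ->
  exists e : R, 0 < e /\ exists Z : R -> 'rV[R]_m,
    [/\ forall t, t < T -> Z t = Y t, Z T = y0 &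
     forall t, t1 < t < T + e -> forall a, is_derive t 1 (fun s => Z s 0 a) (F (Z t) 0 a)].
Proof.
move=> t1T LF dY Ylim; have [e [e0 [S [ST dS]]]] := picard_local T LF.
exists e; split=> //; pose Z t := if t < T then Y t else S t.
have ZT : Z T = y0 by rewrite /Z ltxx.
exists Z; split=> //; first by move=> t tT; rewrite /Z tT.
have dleft t : t1 < t < T -> forall a, is_derive t 1 (fun s => Z s 0 a) (F (Z t) 0 a).
  move=> /andP[t1t tT] a; rewrite {2}/Z tT.
  have := dY t _ a; rewrite t1t tT => /(_ isT); apply: near_eq_is_derive.
  by near=> s; rewrite /Z ifT//; near: s; exact: lt_nbhsl.
have dright t : T < t < T + e -> forall a, is_derive t 1 (fun s => Z s 0 a) (F (Z t) 0 a).
  move=> /andP[Tt te] a; rewrite {2}/Z ltNge (ltW Tt)/=.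
  have te' : `|t - T| < e by rewrite ger0_norm; lra.
  have := dS t te' a; apply: near_eq_is_derive.
  near=> s; rewrite /Z ifF//; apply/negbTE; rewrite -leNgt ltW//.
  by near: s; exact: lt_nbhsr.
have near_le s : (forall d, 0 < d -> \forall t \near T, `|s t - y0| <= d) ->
    forall f, loc_lipschitz y0 f -> s T = y0 -> {for T, continuous (fun t => f (s t))}.
  move=> sn f /loc_lipschitz_cvg cf sT; apply/cvgrPdist_le => d d0; rewrite sT.
  have /cvgrPdist_le/(_ _ d0)/near_normP[r r0 rP] := cf.
  have : \forall t \near T, `|s t - y0| <= r / 2 by apply: sn; rewrite divr_gt0.
  by apply: filterS => t h; apply: rP; apply: le_lt_trans h _; lra.
have Zcont d : 0 < d -> \forall t \near T, `|Z t - y0| <= d.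
  move=> d0; have K1 : 0 < `|K| + 1 by rewrite ltr_wpDl.
  have Sc : \forall t \near T, forall a, `|S t 0 a - y0 0 a| <= d.
    apply: (@filter_forall _ _ _ (nbhs T) (nbhs_filter T)) => a.
    have T0 : `|T - T| < e by rewrite subrr normr0.
    have := is_derive_continuous (dS T T0 a).
    move/cvgrPdist_le => /(_ _ d0); rewrite ST.
    by apply: filterS => t; rewrite distrC.
  near=> t; rewrite /Z; case: ifPn => tT.
    apply: le_trans (Ylim t _) _.
      by rewrite tT andbT; near: t; exact: lt_nbhsr.
    have : T - t <= d / (`|K| + 1).
      have : `|t - T| < d / (`|K| + 1).
        near: t; apply/near_realP; exists (d / (`|K| + 1)) => //; exact: divr_gt0.
      by rewrite ltr_norml => /andP[? ?]; lra.
    rewrite ler_pdivlMr// mulrC; apply: le_trans.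
    apply: ler_wpM2r; first by rewrite subr_ge0 ltW.
    by apply: le_trans (ler_norm K) _; rewrite lerDl.
  apply: norm_le_coord; first exact: ltW.
  by move=> a; rewrite !mxE; move: a; near: t.
move=> t /andP[t1t te] a; have [tT|Tt|tT] := ltgtP t T.
- by apply: dleft; rewrite t1t.
- by apply: dright; rewrite Tt.
rewrite tT; pose d := Num.min e (T - t1).
have d0 : 0 < d by rewrite lt_min e0 subr_gt0.
apply: (removable_derivative (df := fun t => F (Z t) 0 a) d0).
- exact: (near_le Z Zcont (fun y => y 0 a) (loc_lipschitz_coord _ a) ZT).
- exact: (near_le Z Zcont (fun y => F y 0 a) (LF a) ZT).
- move=> s; rewrite lt_min ltr_norml => /andP[/andP[h1 h2]]; rewrite ltr_norml => /andP[h3 h4].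
  rewrite neq_lt => /orP[sT|Ts].
    by apply: dleft; apply/andP; split; lra.
  by apply: dright; apply/andP; split; lra.
Unshelve. all: by end_near. Qed.

End OdeExtension.

(** * The geodesic equation as a first-order system *)

Section GeodesicField.
Context {R : realType} {n : nat} {X : topologicalType}.
Context {M : smooth_manifold R n X} (g : riemannian_metric M).
Implicit Types (i j : idx M) (gamma : R -> X) (t s : R) (y : 'rV[R]_n).

Lemma loc_lipschitz_metric i y (a b : 'I_n) : cimg (atlas i) y ->
  loc_lipschitz y (fun y => metric g i y a b).
Proof. exact: loc_lipschitz_C1 (@chart_open _ _ _ _ i) (@metric_C1 _ _ _ _ g i a b). Qed.

Lemma near_cimg i y : cimg (atlas i) y ->
  exists2 r : R, 0 < r & forall z, `|z - y| < r -> cimg (atlas i) z.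
Proof.
by move=> iy; apply/near_normP; apply: open_nbhs_nbhs; split=> //; exact: chart_open.
Qed.

Lemma loc_lipschitz_invmetric i y (a b : 'I_n) : cimg (atlas i) y ->
  loc_lipschitz y (fun y => invmx (metric g i y) a b).
Proof.
move=> iy; have [r r0 rP] := near_cimg iy.
apply: (loc_lipschitz_invmx r0) => [z /rP iz|k l].
  exact: posdef_unit (metric_posdefW g iz).
exact: loc_lipschitz_metric.
Qed.

Lemma loc_lipschitz_christoffel i y (a b k : 'I_n) : cimg (atlas i) y ->
  loc_lipschitz y (fun y => christoffel g i y a b k).
Proof.
move=> iy; have Lpd c d e : loc_lipschitz y (pd c (fun z => metric g i z d e)).
  apply: (loc_lipschitz_C1 (@chart_open _ _ _ _ i)) iy.
  exact: ((metric_smooth g i d e 2).2 c).2.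
apply: loc_lipschitzM; first exact: loc_lipschitz_cst.
apply: loc_lipschitz_sum => l; apply: loc_lipschitzM; first exact: loc_lipschitz_invmetric.
apply: loc_lipschitzD; first by apply: loc_lipschitzD; exact: Lpd.
under eq_fun do rewrite -mulN1r.
by apply: loc_lipschitzM; [exact: loc_lipschitz_cst|exact: Lpd].
Qed.

Lemma near_bounded (I : finType) y (f : I -> 'rV[R]_n -> R) :
  (forall k, loc_lipschitz y (f k)) ->
  exists B r : R, [/\ 0 <= B, 0 < r & forall z, `|z - y| < r -> forall k, `|f k z| <= B].
Proof.
move=> H; have /choice[B HB] k : exists B, 0 <= B /\ \forall z \near y, `|f k z| <= B.
  have [B [r [B0 r0 BP]]] := loc_lipschitz_bounded (H k).
  by exists B; split=> //; apply/near_normP; exists r.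
exists (\sum_k B k).
have : \forall z \near y, forall k, `|f k z| <= B k.
  by apply: (@filter_forall _ _ _ (nbhs y) (nbhs_filter y)) => k; case: (HB k).
move=> /near_normP[r r0 rP]; exists r; split=> //.
  by apply: sumr_ge0 => k _; case: (HB k).
move=> z /rP zr k; apply: le_trans (zr k) _; rewrite (bigD1 k)//= lerDl.
by apply: sumr_ge0 => l _; case: (HB l).
Qed.

(** By Cauchy-Schwarz, applied to the covector reading off a coordinate, the
    comparison constant is a diagonal entry of the inverse metric, which is bounded
    near a point. *)
Lemma coordinate_speed i y0 : cimg (atlas i) y0 ->
  exists C r : R, [/\ 0 <= C, 0 < r & forall y, `|y - y0| < r ->
    cimg (atlas i) y /\ forall (z : 'I_n -> R) a,
      z a ^+ 2 <= C * \sum_(b < n) \sum_(c < n) metric g i y b c * z b * z c].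
Proof.
move=> iy; have [r1 r10 r1P] := near_cimg iy.
have [C [r2 [C0 r20 CP]]] := near_bounded (fun a => loc_lipschitz_invmetric a a iy).
exists C, (Num.min r1 r2); split=> //; first by rewrite lt_min r10.
move=> y; rewrite lt_min => /andP[/r1P iy' /CP yC]; split=> // z a.
have pG := metric_posdefW g iy'.
pose p : 'rV[R]_n := delta_mx 0 a.
have := dual_cauchy_schwarz p (\row_b z b) pG.
have -> : (p *m (\row_b z b)^T) 0 0 = z a.
  by rewrite /p -rowE !mxE.
have -> : (p *m invmx (metric g i y) *m p^T) 0 0 = invmx (metric g i y) a a.
  by rewrite /p trmx_delta -rowE -colE !mxE.
have -> : \sum_(b < n) \sum_(c < n) metric g i y b c * z b * z c =
    (\row_b z b *m metric g i y *m (\row_b z b)^T) 0 0.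
  by rewrite formE; apply: eq_bigr => b _; apply: eq_bigr => c _; rewrite !mxE.
move=> /le_trans; apply; rewrite ler_wpM2r ?posdef_ge0//.
exact: le_trans (ler_norm _) (yC a).
Qed.

(** The left half of a state is the position, the right half the velocity. *)
Definition geodesic_field i (Y : 'rV[R]_(n + n)) : 'rV[R]_(n + n) :=
  row_mx (rsubmx Y) (\row_k - \sum_(a < n) \sum_(b < n)
    christoffel g i (lsubmx Y) a b k * rsubmx Y 0 a * rsubmx Y 0 b).

Lemma loc_lipschitz_lsubmx (Y : 'rV[R]_(n + n)) f :
  loc_lipschitz (lsubmx Y) f -> loc_lipschitz Y (fun Z => f (lsubmx Z)).
Proof.
have lsub_le (Z Z' : 'rV[R]_(n + n)) : `|lsubmx Z - lsubmx Z'| <= `|Z - Z'|.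
  apply: norm_le_coord => // a; rewrite !mxE.
  by have := coord_le_norm (Z - Z') (lshift n a); rewrite !mxE.
move=> [C [r [C0 r0 H]]]; exists C, r; split=> // Z Z' Zr Zr'.
apply: le_trans (H _ _ (le_lt_trans (lsub_le _ _) Zr) (le_lt_trans (lsub_le _ _) Zr')) _.
by rewrite ler_wpM2l.
Qed.

Lemma loc_lipschitz_geodesic_field i Y (k : 'I_(n + n)) : cimg (atlas i) (lsubmx Y) ->
  loc_lipschitz Y (fun Z => geodesic_field i Z 0 k).
Proof.
move=> iY; have Lr (a : 'I_n) : loc_lipschitz Y (fun Z => (rsubmx Z : 'rV_n) 0 a).
  by under eq_fun do rewrite mxE; exact: loc_lipschitz_coord.
case: (split_ordP k) => l ->; rewrite /geodesic_field.
  by under eq_fun do rewrite row_mxEl; exact: Lr.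
under eq_fun do rewrite row_mxEr mxE -mulN1r.
apply: loc_lipschitzM; first exact: loc_lipschitz_cst.
apply: loc_lipschitz_sum => a; apply: loc_lipschitz_sum => b.
apply: loc_lipschitzM => //; apply: loc_lipschitzM => //.
by apply: (@loc_lipschitz_lsubmx Y (fun y => christoffel g i y a b l));
   exact: loc_lipschitz_christoffel.
Qed.

Lemma cinvK i y : cimg (atlas i) y ->
  cdom (atlas i) (cinv (atlas i) y) /\ cmap (atlas i) (cinv (atlas i) y) = y.
Proof. by move=> [x ix <-]; rewrite cmapK. Qed.

Lemma near_itv (a b t : R) : a < t < b -> \forall s \near t, a < s < b.
Proof.
move=> /andP[at_ tb]; near=> s; apply/andP; split; near: s.
  exact: lt_nbhsr.
exact: lt_nbhsl.
Unshelve. all: by end_near. Qed.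

(** The first-order system gives back velocity and acceleration in the chart [i];
    the equation in the other charts follows from [geodesic_at_change]. *)
Lemma integral_curve_geodesic i (Z : R -> 'rV[R]_(n + n)) gamma (a b : R) :
  (forall t, a < t < b -> cimg (atlas i) (lsubmx (Z t))) ->
  (forall t, a < t < b -> gamma t = cinv (atlas i) (lsubmx (Z t))) ->
  (forall t, a < t < b -> forall k,
    is_derive t 1 (fun s => Z s 0 k) (geodesic_field i (Z t) 0 k)) ->
  forall t, a < t < b -> {for t, continuous gamma} /\
    forall j, cdom (atlas j) (gamma t) -> geodesic_at g j gamma t.
Proof.
move=> iZ gZ dZ.
have it t : a < t < b -> cdom (atlas i) (gamma t).
  by move=> tab; rewrite gZ//; exact: (cinvK (iZ t tab)).1.
have ct t : a < t < b -> {for t, continuous gamma}.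
  move=> tab; have ci := cinv_continuous (iZ t tab).
  have cZ : {for t, continuous (fun s => lsubmx (Z s))}.
    apply/(@cvgrPdist_le _ _ _ (nbhs t)) => d d0.
    have : \forall s \near t, forall k, `|Z t 0 k - Z s 0 k| <= d.
      apply: (@filter_forall _ _ _ (nbhs t) (nbhs_filter t)) => k.
      have := is_derive_continuous (dZ t tab k).
      by move/cvgrPdist_le => /(_ _ d0).
    apply: filterS => s h; apply: norm_le_coord; first exact: ltW.
    by move=> k; rewrite !mxE.
  have : cinv (atlas i) (lsubmx (Z s)) @[s --> t] --> gamma t.
    by rewrite gZ//; exact: cvg_comp cZ ci.
  apply: cvg_trans; apply: near_eq_cvg; near=> s; rewrite gZ//; near: s; exact: near_itv.
have coordE t k : a < t < b -> chart_coord i gamma k t = Z t 0 (lshift n k).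
  by move=> tab; rewrite /chart_coord gZ// (cinvK (iZ t tab)).2 mxE.
have dcoord t k : a < t < b -> is_derive t 1 (chart_coord i gamma k) (Z t 0 (rshift n k)).
  move=> tab; have := dZ t tab (lshift n k).
  rewrite row_mxEl mxE; apply: near_eq_is_derive.
  by near=> s; rewrite coordE//; near: s; exact: near_itv.
have velE t k : a < t < b -> velocity i gamma k t = Z t 0 (rshift n k).
  by move=> tab; rewrite /velocity derive1E; case: (dcoord t k tab).
have gi t : a < t < b -> geodesic_at g i gamma t.
  move=> tab k.
  have dv : is_derive t 1 (velocity i gamma k) (geodesic_field i (Z t) 0 (rshift n k)).
    have := dZ t tab (rshift n k); apply: near_eq_is_derive.
    by near=> s; rewrite velE//; near: s; exact: near_itv.
  split; [by case: (dcoord t k tab)|by case: dv|].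
  rewrite derive1E; case: dv => _ ->; rewrite row_mxEr mxE gZ// (cinvK (iZ t tab)).2.
  rewrite addrC; apply/eqP; rewrite subr_eq0; apply/eqP.
  by apply: eq_bigr => c _; apply: eq_bigr => d _; rewrite !velE// !mxE.
move=> t tab; split; first exact: ct.
move=> j jt.
have : \forall s \near t, cdom (atlas j) (gamma s) /\ a < s < b.
  apply: filterS2 (near_cdom jt (ct t tab)) (near_itv tab) => s h1 h2; by split.
move=> /near_realP[r r0 rP].
have cont_at s : `|s - t| < r -> a < s < b by move=> /rP[].
apply: (@geodesic_at_change _ _ _ _ g i j gamma (ball t r)) => //.
- exact: ball_open.
- exact: ballxx.
- move=> s; rewrite -ball_normE/= distrC => /rP[js sab].
  by split=> //; [exact: it|exact: ct].
- move=> s; rewrite -ball_normE/= distrC => /rP[_ sab] k.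
  by case: (dcoord s k sab).
- exact: gi.
Unshelve. all: by end_near. Qed.

Lemma geodesic_at_near i gamma gamma' t (V : set R) : open V -> V t ->
  (forall s, V s -> gamma s = gamma' s) -> geodesic_at g i gamma t -> geodesic_at g i gamma' t.
Proof.
move=> oV Vt E gt.
have nearV s : V s -> \forall u \near s, V u by move=> Vs; apply: open_nbhs_nbhs.
have Ec k s : V s -> \forall u \near s, chart_coord i gamma k u = chart_coord i gamma' k u.
  by move=> /nearV; apply: filterS => u Vu; rewrite /chart_coord E.
have Ev k s : V s -> velocity i gamma k s = velocity i gamma' k s.
  by move=> Vs; rewrite /velocity !derive1E; apply: near_eq_derive; exact: Ec.
have Evn k : \forall u \near t, velocity i gamma k u = velocity i gamma' k u.
  by have := nearV _ Vt; apply: filterS => u; exact: Ev.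
move=> k; have [d1 d2 e] := gt k; split.
- exact: near_eq_derivable (Ec k t Vt) d1.
- exact: near_eq_derivable (Evn k) d2.
have acc : ((velocity i gamma' k)^`())%classic t = ((velocity i gamma k)^`())%classic t.
  by rewrite !derive1E; apply: near_eq_derive; apply: filterS (Evn k) => u ->.
rewrite acc -(E t Vt).
by under eq_bigr do under eq_bigr do rewrite -!(Ev _ t Vt).
Qed.

End GeodesicField.

(** * Extension of a geodesic past an accumulation point *)

Section Extension.
Context {R : realType} {n : nat} {X : topologicalType}.
Context {M : smooth_manifold R n X} (g : riemannian_metric M).
Implicit Types (i j : idx M) (gamma : R -> X) (t s : R) (y : 'rV[R]_n).

Lemma energy_ge0 i gamma t : cdom (atlas i) (gamma t) -> 0 <= energy g i gamma t.
Proof.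
move=> it; have pG := metric_posdefW g (cimg_cmap it).
have := posdef_ge0 (\row_b velocity i gamma b t) pG; rewrite formE.
by under eq_bigr do under eq_bigr do rewrite !mxE.
Qed.

Lemma speed_bounded (J : set R) gamma : open J -> is_interval J -> geodesic_on g J gamma ->
  exists2 E : R, 0 <= E &
    forall i t, J t -> cdom (atlas i) (gamma t) -> energy g i gamma t = E.
Proof.
move=> oJ iJ geo; have [[t0 Jt0]|noJ] := pselect (J !=set0); last first.
  by exists 0 => // i t Jt; exfalso; apply: noJ; exists t.
exists (energy g (idx_at M (gamma t0)) gamma t0).
  by apply: energy_ge0; exact: mem_chart_at.
move=> i t Jt it; rewrite (energy_cst oJ iJ geo Jt0 Jt).
have [ct gt] := geo t Jt; apply: energy_change => //; first exact: mem_chart_at.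
by move=> k; have [d _ _] := gt i it k; exact: d.
Qed.

Lemma closed_ball_image i y0 (r : R) : (forall y, `|y - y0| <= r -> cimg (atlas i) y) ->
  closed (cinv (atlas i) @` [set y | `|y - y0| <= r]).
Proof.
move=> H; apply: compact_closed; first exact: (mfd_hausdorff M).
apply: continuous_compact.
  apply: continuous_in_subspaceT => y; rewrite inE/= => /H; exact: cinv_continuous.
apply: bounded_closed_compact.
  exists (`|y0| + r); split; first exact: num_real.
  move=> B hB y /= yr; rewrite -(subrK y0 y).
  apply: le_trans (ler_normD _ _) _; apply: le_trans (ltW hB).
  by rewrite addrC lerD2l.
have -> : [set y | `|y - y0| <= r] = closed_ball_ (fun y => `|y|) y0 r.
  by rewrite /closed_ball_ predeqE => y /=; rewrite distrC.
exact: closed_closed_ball_.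
Qed.

(** Bounds on velocity and acceleration that hold in a whole chart ball, because
    the kinetic energy of a geodesic is the same constant at all times. *)
Lemma chart_ball_bounds (J : set R) gamma i y0 :
  open J -> is_interval J -> geodesic_on g J gamma -> cimg (atlas i) y0 ->
  exists V A r : R, [/\ 0 < V, 0 <= A, 0 < r, forall y, `|y - y0| < r -> cimg (atlas i) y &
    forall t, J t -> cdom (atlas i) (gamma t) -> `|cmap (atlas i) (gamma t) - y0| < r ->
      forall k, `|velocity i gamma k t| <= V /\
        `|- \sum_(a < n) \sum_(b < n) christoffel g i (cmap (atlas i) (gamma t)) a b k *
           velocity i gamma a t * velocity i gamma b t| <= A].
Proof.
move=> oJ iJ geo iy0.
have [E E0 EP] := speed_bounded oJ iJ geo.
have [C [r1 [C0 r10 CP]]] := coordinate_speed g iy0.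
have [G [r2 [G0 r20 GP]]] := near_bounded
  (fun abk : 'I_n * 'I_n * 'I_n => loc_lipschitz_christoffel g abk.1.1 abk.1.2 abk.2 iy0).
(* This choice gives [C * E <= V ^+ 2]. *)
pose V := C * E + 1.
have CE0 : 0 <= C * E by rewrite mulr_ge0.
have V0 : 0 < V by rewrite /V ltr_wpDl.
exists V, (\sum_(a < n) \sum_(b < n) G * V * V), (Num.min r1 r2); split=> //.
- by apply: sumr_ge0 => a _; apply: sumr_ge0 => b _; rewrite !mulr_ge0// ltW.
- by rewrite lt_min r10.
- by move=> y; rewrite lt_min => /andP[h _]; case: (CP y h).
move=> t Jt it; rewrite lt_min => /andP[ct1 ct2].
have vel_le a : `|velocity i gamma a t| <= V.
  have h : velocity i gamma a t ^+ 2 <= C * E.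
    by rewrite -(EP i t Jt it); exact: (CP _ ct1).2.
  have : `|velocity i gamma a t| ^+ 2 <= V ^+ 2.
    rewrite real_normK ?num_real//; apply: le_trans h _; rewrite /V.
    by move: (C * E) CE0 => u u0; nra.
  by rewrite ler_sqr ?nnegrE// ltW.
move=> k; split=> //.
rewrite normrN; apply: le_trans (ler_norm_sum _ _ _) _; apply: ler_sum => a _.
apply: le_trans (ler_norm_sum _ _ _) _; apply: ler_sum => b _.
have normM3 (u v w : R) : `|u * v * w| = `|u| * `|v| * `|w| by rewrite !normrM.
rewrite normM3; apply: ler_pM => //; apply: ler_pM => //.
exact: (GP _ ct2 (a, b, k)).
Qed.

(** If a geodesic returns near [x] when [t] tends to [T], its bounded coordinate
    speed leaves it no time to reach the boundary of a chart ball around [x]. *)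
Lemma confined_near_accumulation (J : set R) gamma (t0 T V r : R) (x : X)
    (i := idx_at M x) (y0 := cmap (atlas i) x) :
  geodesic_on g J gamma -> t0 < T -> (forall t, t0 <= t < T -> J t) ->
  (forall V : set X, nbhs x V -> forall s, s < T -> exists2 t, s < t < T & V (gamma t)) ->
  0 < V -> 0 < r -> (forall y, `|y - y0| < r -> cimg (atlas i) y) ->
  (forall t, J t -> cdom (atlas i) (gamma t) -> `|cmap (atlas i) (gamma t) - y0| < r ->
    forall k, `|velocity i gamma k t| <= V) ->
  exists2 t1, t0 <= t1 < T & forall t, t1 <= t < T ->
    cdom (atlas i) (gamma t) /\ `|cmap (atlas i) (gamma t) - y0| <= 3 / 4 * r.
Proof.
move=> geo t0T sJ acc V0 r0 ball_cimg vel_le.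
have ix : cdom (atlas i) x by exact: mem_chart_at.
have r34 : 3 / 4 * r < r by move: (r) r0 => *; lra.
pose c t := cmap (atlas i) (gamma t).
pose P t := cdom (atlas i) (gamma t) /\ `|c t - y0| < r.
have Popen t : J t -> P t -> \forall s \near t, P s.
  move=> Jt [it ctr]; have [ct _] := geo t Jt.
  have h1 : \forall s \near t, cdom (atlas i) (gamma s) := near_cdom it ct.
  have cc : {for t, continuous c}.
    exact: continuous_comp ct (cmap_continuous it).
  have h2 : \forall s \near t, `|c s - y0| < r.
    apply: (cc [set y | `|y - y0| < r]); apply/near_normP; exists (r - `|c t - y0|).
      by rewrite subr_gt0.
    by move=> y h; apply: le_lt_trans (ler_distD (c t) _ _) _; lra.
  by apply: filterS2 h1 h2.
(* The remaining time allows a displacement of at most r/4, so that a start in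
   the ball of radius r/2 leads to the closed ball of radius 3r/4. *)
have [t1 [/andP[t01 t1T] Tt1 Pt1 ct1]] : exists t1, [/\ t0 <= t1 < T,
    V * (T - t1) < r / 4, P t1 & `|c t1 - y0| < r / 2].
  have W : nbhs x [set z | cdom (atlas i) z /\ `|cmap (atlas i) z - y0| < r / 2].
    have h1 : \forall z \near x, cdom (atlas i) z.
      by apply: open_nbhs_nbhs; split=> //; exact: cdom_open.
    have h2 : \forall z \near x, `|cmap (atlas i) z - y0| < r / 2.
      have cc : {for x, continuous (cmap (atlas i))} := cmap_continuous ix.
      apply: (cc [set y | `|y - y0| < r / 2]); apply/near_normP.
      by exists (r / 2) => //; rewrite divr_gt0.
    exact: filterS2 h1 h2.
  have rV0 : 0 < r / 4 / V by rewrite !divr_gt0.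
  have [|t /andP[h tT] [it ct]] := acc _ W (Num.max t0 (T - r / 4 / V)).
    by rewrite gt_max t0T/= ltrBlDr ltrDl.
  move: h; rewrite gt_max => /andP[t0t h]; exists t; split=> //.
  - by rewrite tT andbT ltW.
  - by rewrite mulrC -ltr_pdivlMr//; lra.
  - by split=> //; apply: lt_trans ct _; rewrite ltr_pdivrMr// ltr_pMr// ltr1n.
have J1 t : t1 <= t < T -> J t.
  by move=> /andP[h1 h2]; apply: sJ; rewrite (le_trans t01).
have stay (b t : R) : b <= T -> (forall s, t1 <= s < b -> P s) -> t1 <= t < b ->
    `|c t - y0| <= 3 / 4 * r.
  move=> bT Pb /andP[t1t tb].
  have lip : `|c t - c t1| <= V * `|t - t1|.
    apply: norm_le_coord => [|k]; first by rewrite mulr_ge0// ltW.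
    rewrite !mxE; apply: (@derive_bound_lipschitz _ (chart_coord i gamma k)
      (velocity i gamma k) [set s | t1 <= s < b]).
    - by move=> u v /= /andP[t1u _] /andP[_ vb] w /andP[uw wv];
        rewrite (le_trans t1u uw) (le_lt_trans wv vb).
    - move=> u /= /andP[t1u ub]; have Pu : P u by apply: Pb; rewrite t1u.
      have Ju : J u by apply: J1; rewrite t1u (lt_le_trans ub).
      by apply: is_derive_chart_coord; have [d _ _] := (geo u Ju).2 i Pu.1 k; exact: d.
    - move=> u /= /andP[t1u ub]; have [iu cu] : P u by apply: Pb; rewrite t1u.
      by apply: vel_le => //; apply: J1; rewrite t1u (lt_le_trans ub).
    - by rewrite /= t1t.
    - by rewrite /= lexx (le_lt_trans t1t tb).
  have far : V * `|t - t1| <= V * (T - t1).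
    rewrite ler_wpM2l ?(ltW V0)// ger0_norm ?subr_ge0// lerD2r.
    exact: ltW (lt_le_trans tb bT).
  apply: le_trans (ler_distD (c t1) _ _) _.
  by move: Tt1 ct1 lip far; clear; move: (V * _) (V * _) (`|_|) (`|_|) => *; lra.
have Ptail t : t1 <= t < T -> P t.
  move=> /andP[t1t tT]; apply: (@real_induction _ P t1 t) => //; last by rewrite t1t lexx.
    move=> s /andP[t1s st] Ps; have Ps' : P s by apply: Ps; rewrite t1s lexx.
    have Js : J s by apply: J1; rewrite t1s (lt_trans st).
    have /near_realP[d d0 dP] := Popen s Js Ps'.
    by exists d => // u /andP[su ud]; apply: dP; rewrite gtr0_norm ?subr_gt0// ltrBlDl.
  move=> s /andP[t1s st] Ps.
  have sT : s < T := le_lt_trans st tT.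
  have Js : J s by apply: J1; rewrite (ltW t1s).
  set K := cinv (atlas i) @` [set y | `|y - y0| <= 3 / 4 * r].
  have clK : closed K.
    by apply: closed_ball_image => y yr; apply: ball_cimg; exact: le_lt_trans yr r34.
  have Ks : K (gamma s).
    apply: contrapT => nK; have [cs _] := geo s Js.
    have : \forall u \near s, (~` K) (gamma u).
      by apply: cs; apply: open_nbhs_nbhs; split=> //; exact: closed_openC.
    move=> /near_realP[d d0 dP].
    pose u := Num.max t1 (s - d / 2).
    have d2 : 0 < d / 2 by rewrite divr_gt0.
    have us : u < s by rewrite gt_max t1s/= ltrBlDr ltrDl.
    have t1u : t1 <= u by rewrite le_max lexx.
    have ud : s - d / 2 <= u by rewrite le_max lexx orbT.
    apply: (dP u).
      rewrite distrC gtr0_norm ?subr_gt0//; move: ud d2; clear; lra.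
    have [iu _] : P u by apply: Ps; rewrite t1u us.
    exists (c u); last by rewrite /c cmapK.
    by apply: (stay s u (ltW sT) Ps); rewrite t1u us.
  have [y /= yr ys] := Ks.
  have iy : cimg (atlas i) y by apply: ball_cimg; exact: le_lt_trans yr r34.
  have [h1 h2] := cinvK iy; rewrite /P /c -ys h2; split=> //.
  exact: le_lt_trans yr r34.
exists t1; first by rewrite t01.
by move=> t h; split; [exact: (Ptail t h).1|exact: (stay T t)].
Qed.

(** In the chart ball position and velocity are Lipschitz functions of [t], hence
    converge as [t] tends to [T]; the geodesic is continued by the solution of the
    geodesic equation with the limits as initial data. *)
Lemma extend_at_accumulation (J : set R) gamma (t0 T : R) (x : X) :
  open J -> is_interval J -> geodesic_on g J gamma ->
  t0 < T -> (forall t, t0 <= t < T -> J t) -> (forall t, J t -> t < T) ->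
  (forall V : set X, nbhs x V -> forall s, s < T -> exists2 t, s < t < T & V (gamma t)) ->
  exists (gamma' : R -> X) (e : R), [/\ 0 < e, forall t, t < T -> gamma' t = gamma t &
    geodesic_on g (J `|` `]t0, (T + e)[) gamma'].
Proof.
move=> oJ iJ geo t0T sJ JT acc.
set i := idx_at M x; set y0 := cmap (atlas i) x.
have iy0 : cimg (atlas i) y0 by apply: cimg_cmap; exact: mem_chart_at.
have [V [A [r [V0 A0 r0 ball_cimg bounds]]]] := chart_ball_bounds oJ iJ geo iy0.
have [t1 /andP[t01 t1T] tail] := confined_near_accumulation geo t0T sJ acc V0 r0 ball_cimg
  (fun t Jt it ct k => (bounds t Jt it ct k).1).
have J1 t : t1 <= t < T -> J t.
  by move=> /andP[h1 h2]; apply: sJ; rewrite (le_trans t01).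
pose c t := cmap (atlas i) (gamma t).
pose ddc k t := - \sum_(a < n) \sum_(b < n)
  christoffel g i (c t) a b k * velocity i gamma a t * velocity i gamma b t.
have r34 : 3 / 4 * r < r by move: (r) r0 => *; lra.
have bounds1 t : t1 <= t < T -> forall k, `|velocity i gamma k t| <= V /\ `|ddc k t| <= A.
  move=> ht; have [it ct] := tail t ht.
  by apply: bounds => //; [exact: J1|exact: le_lt_trans ct r34].
have dcoord t : t1 <= t < T -> forall k,
    is_derive t 1 (chart_coord i gamma k) (velocity i gamma k t).
  move=> ht k; have [it _] := tail t ht.
  by apply: is_derive_chart_coord; have [d _ _] := (geo t (J1 t ht)).2 i it k; exact: d.
have dvel t : t1 <= t < T -> forall k, is_derive t 1 (velocity i gamma k) (ddc k t).
  move=> ht k; have [it _] := tail t ht.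
  have gi : geodesic_at g i gamma t := (geo t (J1 t ht)).2 i it.
  have [_ d /eqP] := gi k; rewrite addr_eq0 derive1E => /eqP e.
  by rewrite /ddc -e; exact: derivableP.
have T1 s : t1 < s < T -> t1 <= s < T by move=> /andP[h ->]; rewrite ltW.
have itv1 : is_interval [set s | t1 <= s < T].
  move=> u v /= /andP[t1u _] /andP[_ vT] w /andP[uw wv].
  by rewrite (le_trans t1u uw) (le_lt_trans wv vT).
have /choice[yT HyT] k : exists l, forall t,
    t1 < t < T -> `|chart_coord i gamma k t - l| <= V * (T - t).
  apply: lipschitz_left_limit => // s t /T1 hs /T1 ht.
  apply: (derive_bound_lipschitz itv1 (fun u hu => dcoord u hu k)) => // u hu.
  exact: (bounds1 u hu k).1.
have /choice[wT HwT] k : exists l, forall t,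
    t1 < t < T -> `|velocity i gamma k t - l| <= A * (T - t).
  apply: lipschitz_left_limit => // s t /T1 hs /T1 ht.
  apply: (derive_bound_lipschitz itv1 (fun u hu => dvel u hu k)) => // u hu.
  exact: (bounds1 u hu k).2.
pose Y0 : 'rV[R]_(n + n) := row_mx (\row_k yT k) (\row_k wT k).
pose Y t : 'rV[R]_(n + n) := row_mx (c t) (\row_k velocity i gamma k t).
have lY0 : lsubmx Y0 = \row_k yT k by rewrite row_mxKl.
have iY0 : cimg (atlas i) (lsubmx Y0).
  apply: ball_cimg; rewrite lY0; pose d := Num.min (T - t1) (r / 4 / V) / 2.
  have m0 : 0 < Num.min (T - t1) (r / 4 / V) by rewrite lt_min subr_gt0 t1T !divr_gt0.
  have d0 : 0 < d by rewrite divr_gt0.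
  have : d < Num.min (T - t1) (r / 4 / V) by rewrite ltr_pdivrMr// ltr_pMr// ltr1n.
  rewrite lt_min => /andP[dT]; rewrite ltr_pdivlMr// => dV.
  have tab : t1 < T - d < T by rewrite ltrBrDl -ltrBrDr dT/= ltrBlDr ltrDl.
  apply: le_lt_trans (ler_distD (c (T - d)) _ _) _.
  have h1 : `|\row_k yT k - c (T - d)| <= V * d.
    apply: norm_le_coord; first by rewrite mulr_ge0// ltW.
    by move=> k; rewrite !mxE distrC; have := HyT k _ tab; rewrite subKr.
  have [_ h2] := tail _ (T1 _ tab).
  rewrite mulrC in dV; move: h1 h2 dV; clear; move: (V * _) (`|_|) (`|_|) => *; lra.
have [|||e [e0 [Z [Zleft ZT dZ]]]] :=
    @ode_extend R (n + n) (geodesic_field g i) Y Y0 t1 T (V + A) t1T.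
- by move=> k; exact: loc_lipschitz_geodesic_field.
- move=> t tab k; have hab := T1 t tab; case: (split_ordP k) => l ->.
    rewrite row_mxEl mxE row_mxEr mxE.
    apply: is_derive_ext (dcoord t hab l) => s.
    by rewrite row_mxEl.
  rewrite row_mxEr mxE row_mxKl row_mxKr.
  have d := dvel t hab l.
  have -> : - \sum_(a < n) \sum_(b < n) christoffel g i (c t) a b l *
      (\row_k velocity i gamma k t) 0 a * (\row_k velocity i gamma k t) 0 b = ddc l t.
    by congr (- _); apply: eq_bigr => a _; apply: eq_bigr => b _; rewrite !mxE.
  by apply: is_derive_ext d => s; rewrite row_mxEr mxE.
- move=> t tab; have /andP[_ tT] := tab.
  have Tt0 : 0 <= T - t by rewrite subr_ge0 ltW.
  apply: norm_le_coord; first by rewrite mulr_ge0// addr_ge0// ltW.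
  move=> k; rewrite mxE [(- Y0) 0 k]mxE mulrDl; case: (split_ordP k) => l ->.
    rewrite !row_mxEl [X in _ - X]mxE; apply: le_trans (HyT l t tab) _.
    by rewrite lerDl mulr_ge0.
  rewrite !row_mxEr !mxE; apply: le_trans (HwT l t tab) _.
  by rewrite lerDr mulr_ge0// ltW.
have [e' e'0 e'P] : exists2 e', 0 < e' & forall t, `|t - T| < e' ->
    t1 < t < T + e /\ cimg (atlas i) (lsubmx (Z t)).
  have iT : t1 < T < T + e by rewrite t1T ltrDl.
  have cZ : \forall t \near T, cimg (atlas i) (lsubmx (Z t)).
    have [d d0 dP] := near_cimg iY0.
    have : \forall t \near T, forall k, `|Z T 0 k - Z t 0 k| <= d / 2.
      apply: (@filter_forall _ _ _ (nbhs T) (nbhs_filter T)) => k.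
      have := is_derive_continuous (dZ T iT k).
      by move/cvgrPdist_le => /(_ (d / 2)); apply; rewrite divr_gt0.
    apply: filterS => t h; apply: dP.
    apply: (@le_lt_trans _ _ (d / 2)); last by rewrite ltr_pdivrMr// ltr_pMr// ltr1n.
    apply: norm_le_coord; first by rewrite divr_ge0// ltW.
    by move=> k; have := h (lshift n k); rewrite ZT distrC !mxE.
  by apply/near_realP; exact: filterS2 (near_itv iT) cZ.
(* The values of the old geodesic are kept before [T], also outside the chart. *)
pose gamma' t := if t < T then gamma t else cinv (atlas i) (lsubmx (Z t)).
have T' : T + e' / 2 < T + e' by rewrite ltrD2l ltr_pdivrMr// ltr_pMr// ltr1n.
exists gamma', e'; split; [exact: e'0|by move=> t tT; rewrite /gamma' tT|].
have Zl t : t1 < t < T -> lsubmx (Z t) = c t.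
  by move=> /andP[_ tT]; rewrite Zleft// row_mxKl.
have iZ t : t1 < t < T + e' -> cimg (atlas i) (lsubmx (Z t)).
  move=> /andP[t1t te]; have [tT|Tt] := ltP t T.
    have tab : t1 < t < T by rewrite t1t.
    by rewrite Zl//; apply: cimg_cmap; exact: (tail t (T1 t tab)).1.
  by apply: (e'P t _).2; rewrite ger0_norm ?subr_ge0// ltrBlDl.
have gZ t : t1 < t < T + e' -> gamma' t = cinv (atlas i) (lsubmx (Z t)).
  move=> /andP[t1t te]; rewrite /gamma'; case: ifP => // tT.
  have tab : t1 < t < T by rewrite t1t.
  by rewrite Zl// cmapK//; exact: (tail t (T1 t tab)).1.
have dZ' t : t1 < t < T + e' -> forall k,
    is_derive t 1 (fun s => Z s 0 k) (geodesic_field g i (Z t) 0 k).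
  move=> /andP[t1t te]; apply: dZ; rewrite t1t/=.
  have [tT|Tt] := ltP t T; first by rewrite (lt_trans tT)// ltrDl.
  have te' : `|t - T| < e' by rewrite ger0_norm ?subr_ge0// ltrBlDl.
  by have [/andP[]] := e'P t te'.
move=> t Ut; have [tT|Tt] := ltP t T; last first.
  apply: (integral_curve_geodesic iZ gZ dZ'); rewrite (lt_le_trans t1T Tt)/=.
  case: Ut => [/JT|]; first by rewrite ltNge Tt.
  by rewrite /= in_itv/= => /andP[].
have Jt : J t.
  case: Ut => //; rewrite /= in_itv/= => /andP[t0t _]; apply: sJ.
  by rewrite (ltW t0t) tT.
have [ct gt] := geo t Jt.
have gt' : gamma' t = gamma t by rewrite /gamma' tT.
split.
  have : gamma s @[s --> t] --> gamma' t by rewrite gt'; exact: ct.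
  apply: cvg_trans; apply: near_eq_cvg; near=> s; rewrite /gamma' ifT//.
  by near: s; exact: lt_nbhsl.
move=> j jt'; have jt : cdom (atlas j) (gamma t) by rewrite -gt'.
have E' s : [set s | s < T] s -> gamma s = gamma' s.
  by rewrite /= /gamma' => ->.
exact: (geodesic_at_near (@open_lt R T) tT E' (gt j jt)).
Unshelve. all: by end_near. Qed.

End Extension.

(** * Geodesics accumulate under the strong Laplacian principle *)

Lemma derive_ge_right (R : realType) (f : R -> R) (t d K e : R) : is_derive t 1 f d -> 0 < e ->
  (forall h, 0 < h < e -> f t + K * h <= f (t + h)) -> K <= d.
Proof.
move=> /is_derive_cvgP df e0 H; rewrite leNgt; apply/negP => dK.
have Kd : 0 < K - d by rewrite subr_gt0.
have /cvgrPdist_lt/(_ _ Kd) near0 := df.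
have : \forall h \near (0 : R), h != 0 -> `|d - h^-1 * (f (t + h) - f t)| < K - d.
  exact: near0.
move=> /near_realP[r r0 rP].
pose h := Num.min e r / 2.
have m0 : 0 < Num.min e r by rewrite lt_min e0.
have h0 : 0 < h by rewrite divr_gt0.
have hm : h < Num.min e r by rewrite ltr_pdivrMr// ltr_pMr// ltr1n.
have [he hr] : h < e /\ h < r by move: hm; rewrite lt_min => /andP[].
have := rP h; rewrite subr0 gtr0_norm// => /(_ hr (lt0r_neq0 h0)).
rewrite ltr_norml => /andP[q _].
have : K <= h^-1 * (f (t + h) - f t).
  rewrite mulrC ler_pdivlMr//; have := H h; rewrite h0 he => /(_ isT).
  by move: (K * h) => v ?; lra.
by move: q; move: (h^-1 * _) => v ? ?; lra.
Qed.

Section PassageTime.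
Context {R : realType} {X : topologicalType} (haus : hausdorff_space X).
Context (gamma : R -> X) (t0 T : R).
Implicit Types (t s : R) (x : X).

Definition visits x := [set t | t0 <= t < T /\ gamma t = x].

(** Time of the last visit, counted from [t0] and multiplied by [K]; it is [-oo]
    off the curve, as the supremum of the empty set. *)
Definition passage_time (K : R) x : \bar R :=
  ereal_sup [set (K * (t - t0))%:E | t in visits x].

(** No accumulation point when [t] tends to [T]. *)
Definition escapes := forall x, exists (V : set X) s,
  [/\ nbhs x V, t0 <= s < T & forall t, s < t < T -> ~ V (gamma t)].

Context (cont : forall t, t0 <= t < T -> {for t, continuous gamma}).
Context (escape : escapes).

Lemma closed_pt x : closed [set x].
Proof. by apply: compact_closed => //; exact: compact_set1. Qed.

Lemma near_ne t x : t0 <= t < T -> gamma t <> x ->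
  \forall s \near t, gamma s <> x.
Proof.
move=> ht ne; have ct := cont ht.
have : \forall y \near gamma t, (~` [set x]) y.
  by apply: open_nbhs_nbhs; split=> //; apply: closed_openC; exact: closed_pt.
exact: ct.
Qed.

Lemma last_visit x : visits x !=set0 ->
  exists2 s, visits x s & forall t, visits x t -> t <= s.
Proof.
move=> S0; have [V [s [Vx /andP[t0s sT] noV]]] := escape x.
have Sle t : visits x t -> t <= s.
  move=> [/andP[t0t tT] tx]; rewrite leNgt; apply/negP => st.
  by apply: (noV t); rewrite ?st// tx; exact: nbhs_singleton.
have supS : has_sup (visits x) by split=> //; exists s.
have s12 : t0 <= sup (visits x) < T.
  rewrite (le_lt_trans (ge_sup _ Sle) sT)// andbT.
  have [t St] := S0; apply: le_trans (ub_le_sup supS.2 St).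
  by case: St => /andP[].
exists (sup (visits x)); last by move=> t St; exact: (ub_le_sup supS.2 St).
split=> //; apply: contrapT => /(near_ne s12)/near_realP[d d0 dP].
have [t St lt] := sup_adherent d0 supS.
apply: (dP t); last by case: St.
by rewrite distrC ger0_norm ?subr_ge0 ?(ub_le_sup supS.2)//; lra.
Qed.

(** Otherwise the curve would stay at its starting point by continuity, but a
    constant curve does not escape. *)
Lemma start_not_isolated V : t0 < T -> nbhs (gamma t0) V ->
  exists2 y, V y & y <> gamma t0.
Proof.
move=> t0T Vx; apply: contrapT => H.
have VU y : V y -> y = gamma t0.
  by move=> Vy; apply: contrapT => ne; apply: H; exists y.
have cst b : t0 <= b < T -> gamma b = gamma t0.
  move=> /andP[t0b bT]; apply: (@real_induction _ [set r | gamma r = gamma t0] t0 b) => //=.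
  - move=> r /andP[t0r rb] /(_ r); rewrite t0r lexx => /(_ isT) rx.
    have rin : t0 <= r < T by rewrite t0r (lt_trans rb).
    have : \forall q \near r, V (gamma q) by have cr := cont rin; apply: cr; rewrite rx.
    move=> /near_realP[d d0 dP]; exists d => // q /andP[rq qd]; apply: VU; apply: dP.
    by rewrite gtr0_norm ?subr_gt0//; lra.
  - move=> r /andP[t0r rb] Hr; apply: contrapT => ne.
    have rin : t0 <= r < T by rewrite (ltW t0r) (le_lt_trans rb).
    have /near_realP[d d0 dP] := near_ne rin ne.
    pose q := Num.max t0 (r - d / 2).
    have qr : q < r by rewrite gt_max t0r/=; lra.
    have t0q : t0 <= q by rewrite le_max lexx.
    have dq : r - d / 2 <= q by rewrite le_max lexx orbT.
    apply: (dP q); last by apply: Hr; rewrite t0q.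
    by rewrite distrC gtr0_norm ?subr_gt0//; lra.
  - by rewrite t0b lexx.
have [W [s [Wx /andP[t0s sT] noW]]] := escape (gamma t0).
apply: (noW ((s + T) / 2)); first by apply/andP; split; lra.
have -> : gamma ((s + T) / 2) = gamma t0 by apply: cst; apply/andP; split; lra.
exact: nbhs_singleton Wx.
Qed.

Context (K : R) (K0 : 0 < K).
Local Notation u := (passage_time K).

Lemma passage_time_ge x t : visits x t -> ((K * (t - t0))%:E <= u x)%E.
Proof. by move=> Sxt; apply: ereal_sup_ubound; exists t. Qed.

Lemma passage_time_le x : (u x <= (K * (T - t0))%:E)%E.
Proof.
apply: ge_ereal_sup => _ [t [/andP[_ tT] _] <-].
by rewrite lee_fin ler_wpM2l ?(ltW K0)// lerD2r ltW.
Qed.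

Lemma passage_time_out x : ~ (visits x !=set0) -> u x = -oo%E.
Proof.
move=> S0; rewrite /passage_time (_ : [set _ | _ in _] = set0) ?ereal_sup0//.
by rewrite -subset0 => r [t St _]; apply: S0; exists t.
Qed.

Lemma passage_time_last x : visits x !=set0 ->
  exists2 s, visits x s & u x = (K * (s - t0))%:E.
Proof.
move=> /last_visit[s Ss sP]; exists s => //.
apply/eqP; rewrite eq_le passage_time_ge// andbT.
apply: ge_ereal_sup => _ [t St <-]; rewrite lee_fin ler_wpM2l ?(ltW K0)// lerD2r.
exact: sP.
Qed.

(** Near [x] only a compact part of the curve has to be looked at, and the points
    of it visited at or after a given time form a closed set. *)
Lemma passage_time_usc x (a : R) : (u x < a%:E)%E -> \forall y \near x, (u y < a%:E)%E.
Proof.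
move=> uxa; have [b uxb ba] : exists2 b : R, (u x < b%:E)%E & b < a.
  have [S0|S0] := pselect (visits x !=set0); last first.
    by exists (a - 1); [rewrite passage_time_out// ltNyr|rewrite ltrBlDr ltrDl].
  have [s _ us] := passage_time_last S0; move: uxa; rewrite us lte_fin => h.
  exists ((K * (s - t0) + a) / 2); last by move: h; move: (K * _) => v h; lra.
  by rewrite lte_fin; move: h; move: (K * _) => v h; lra.
have [V [s [Vx /andP[t0s sT] noV]]] := escape x.
pose C := gamma @` [set` `[Num.max t0 (t0 + b / K), s]].
have clC : closed C.
  apply: compact_closed => //; apply: continuous_compact; last exact: segment_compact.
  apply: continuous_in_subspaceT => t; rewrite inE/= in_itv/= ge_max => /andP[/andP[h _] ts].
  by apply: cont; rewrite h (le_lt_trans ts).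
have nCx : ~ C x.
  move=> [t]; rewrite /= in_itv/= ge_max => /andP[/andP[t0t h] ts] tx.
  have Sxt : visits x t by split=> //; rewrite t0t (le_lt_trans ts).
  have := le_lt_trans (passage_time_ge Sxt) uxb; rewrite lte_fin ltNge => /negP; apply.
  by rewrite mulrC -ler_pdivrMr// lerBrDl.
have nearC : \forall y \near x, (~` C) y.
  by apply: open_nbhs_nbhs; split=> //; exact: closed_openC.
apply: filterS2 nearC Vx => y nC Vy; apply: (@le_lt_trans _ _ b%:E); last by rewrite lte_fin.
apply: ge_ereal_sup => _ [t [/andP[t0t tT] ty] <-]; rewrite lee_fin.
rewrite leNgt; apply/negP => bt; apply: nC; exists t => //.
rewrite /= in_itv/= ge_max t0t/=; apply/andP; split.
  by rewrite -lerBrDl ler_pdivrMr// mulrC ltW.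
rewrite leNgt; apply/negP => st; apply: (noV t); first by rewrite st.
by rewrite ty.
Qed.

End PassageTime.

Section Ahlfors.
Context {R : realType} {n : nat} {X : topologicalType}.
Context {M : smooth_manifold R n X} (g : riemannian_metric M).
Implicit Types (i j : idx M) (gamma : R -> X) (t s : R).

(** A test function lying above the passage time grows along the curve at rate at
    least [K = E + 1]; by Cauchy-Schwarz its gradient has norm at least [K] divided
    by the speed [sqrt E], which is smaller than [K]. Points off the curve have no
    test function, the value there being [-oo]. *)
Lemma passage_time_test (J : set R) gamma (t0 T E : R) x phi :
  geodesic_on g J gamma -> (forall t, t0 <= t < T -> J t) ->
  escapes gamma t0 T ->
  0 <= E ->
  (forall i t, J t -> cdom (atlas i) (gamma t) -> energy g i gamma t = E) ->
  @is_test R n X M (passage_time gamma t0 T (E + 1)) x phi ->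
  1 <= covector_norm g x (jcov (jet2_of g x phi)).
Proof.
move=> geo sJ escape E0 EP.
have cont t : t0 <= t < T -> {for t, continuous gamma} by move=> /sJ/geo[].
have K0 : 0 < E + 1 by rewrite ltr_wpDl.
set K := E + 1 in K0 *; set u := passage_time gamma t0 T K.
move=> [[W [oW Wx] CW] phi_ge phi_x].
set i := idx_at M x in oW Wx CW; set f := phi \o cinv (atlas i) in CW.
have ix : cdom (atlas i) x by exact: mem_chart_at.
have S0 : visits gamma t0 T x !=set0.
  by apply: contrapT => S0; move: phi_x; rewrite /u passage_time_out.
have [s [/andP[t0s sT] sx] us] := passage_time_last (mfd_hausdorff M) cont escape K0 S0.
have s_in : t0 <= s < T by rewrite t0s.
have Js := sJ _ s_in; have [cs gs] := geo s Js.
have is_ : cdom (atlas i) (gamma s) by rewrite sx.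
have ds k : derivable (chart_coord i gamma k) s 1 by have [d _ _] := gs i is_ k; exact: d.
have Ws : W (cmap (atlas i) (gamma s)) by rewrite sx.
have df := @is_derive_curve R n W f (fun r => cmap (atlas i) (gamma r)) s
  (fun k => velocity i gamma k s) oW (Ck_onS CW) Ws
  (fun k => is_derive_chart_coord (ds k)).
have near_s : \forall r \near s, [/\ cdom (atlas i) (gamma r),
    (u (gamma r) <= (phi (gamma r))%:E)%E & r < T].
  have h1 := near_cdom is_ cs.
  have h2 : \forall r \near s, (u (gamma r) <= (phi (gamma r))%:E)%E.
    by apply: (cs [set y | (u y <= (phi y)%:E)%E]); rewrite sx.
  have h3 : \forall r \near s, r < T by exact: lt_nbhsl.
  by near=> r; split; near: r.
have [e e0 eP] : exists2 e : R, 0 < e & forall r, `|r - s| < e ->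
  [/\ cdom (atlas i) (gamma r), (u (gamma r) <= (phi (gamma r))%:E)%E & r < T].
  exact/near_realP.
have fE r : cdom (atlas i) (gamma r) -> f (cmap (atlas i) (gamma r)) = phi (gamma r).
  by move=> ir; rewrite /f/= cmapK.
have dK := derive_ge_right df e0 (K := K).
have {dK} : K <= \sum_(a < n) velocity i gamma a s * pd a f (cmap (atlas i) (gamma s)).
  apply: dK => h /andP[h0 he]; have [|ir phir rT] := eP (s + h).
    by rewrite addrAC subrr add0r gtr0_norm.
  rewrite !fE// -lee_fin; apply: le_trans phir.
  have -> : phi (gamma s) + K * h = K * (s + h - t0).
    have : phi x = K * (s - t0) by apply: EFin_inj; rewrite phi_x /u us.
    by rewrite sx => ->; ring.
  by apply: passage_time_ge; split=> //; rewrite rT andbT; lra.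
rewrite sx => dK.
have pG := metric_posdefW g (cimg_cmap ix).
have := dual_cauchy_schwarz (\row_a pd a f (cmap (atlas i) x))
   (\row_a velocity i gamma a s) pG.
have -> : ((\row_a pd a f (cmap (atlas i) x)) *m (\row_a velocity i gamma a s)^T) 0 0 =
    \sum_(a < n) velocity i gamma a s * pd a f (cmap (atlas i) x).
  by rewrite mxE; apply: eq_bigr => a _; rewrite !mxE mulrC.
have -> : (\row_a velocity i gamma a s *m metric g i (cmap (atlas i) x) *m
    (\row_a velocity i gamma a s)^T) 0 0 = E.
  rewrite -(EP i s Js is_) formE /energy sx.
  by apply: eq_bigr => a _; apply: eq_bigr => b _; rewrite !mxE.
rewrite /covector_norm /metric_at -/i /=.
move: (_ 0 0) (\sum_(a < n) _) dK => q d dK h.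
rewrite -sqrtr1 ler_wsqrtr// leNgt; apply/negP => q1.
have : K ^+ 2 <= d ^+ 2 by rewrite ler_sqr ?nnegrE ?(ltW K0)// (le_trans (ltW K0)).
have : q * E <= E by rewrite ler_piMl// ltW.
rewrite /K; move: (q * E) (d ^+ 2) h => v w ? ? ?; nra.
Unshelve. all: by end_near. Qed.

(** If the end of the curve had no accumulation point, the passage time would be a
    bounded function satisfying the differential inequality on the complement of
    the starting point, yet larger inside than on the boundary. *)
Lemma accumulation_point (J : set R) gamma (t0 T : R) :
  strong_laplacian_principle g ->
  open J -> is_interval J -> geodesic_on g J gamma ->
  t0 < T -> (forall t, t0 <= t < T -> J t) ->
  exists x : X, forall V : set X, nbhs x V -> forall s, s < T ->
    exists2 t, s < t < T & V (gamma t).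
Proof.
move=> slp oJ iJ geo t0T sJ; apply: contrapT => noacc.
have escape : escapes gamma t0 T.
  move=> x; apply: contrapT => H; apply: noacc; exists x => V Vx s sT; apply: contrapT => H'.
  apply: H; exists V, (Num.max s t0); split=> //; first by rewrite le_max lexx orbT gt_max sT.
  move=> t; rewrite gt_max => /andP[/andP[st _] tT] Vt; apply: H'; exists t => //.
  by rewrite st.
have cont t : t0 <= t < T -> {for t, continuous gamma} by move=> /sJ/geo[].
have haus := mfd_hausdorff M.
have [E E0 EP] := speed_bounded oJ iJ geo.
pose K := E + 1; have K0 : 0 < K by rewrite ltr_wpDl.
pose u := passage_time gamma t0 T K.
pose S := visits gamma t0 T.
have u_le x : (u x <= (K * (T - t0))%:E)%E by exact: passage_time_le.
have u_ge x t : S x t -> ((K * (t - t0))%:E <= u x)%E by exact: passage_time_ge.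
(* On the boundary of [U] the value of [u] is given by the time [s0 < T] of the
   last visit to the starting point; in [U] larger values occur after [s0]. *)
pose U := ~` [set gamma t0].
have oU : open U by apply: closed_openC; exact: closed_pt.
have S00 : S (gamma t0) t0 by rewrite /S/visits/= lexx t0T.
have [s0 [/andP[t0s0 s0T] s0x] us0] : exists2 s, S (gamma t0) s &
  u (gamma t0) = (K * (s - t0))%:E.
  by apply: (passage_time_last haus cont escape K0); exists t0.
pose t := (s0 + T) / 2.
have s0t : s0 < t by rewrite /t; lra.
have tT : t < T by rewrite /t; lra.
have Ut : U (gamma t).
  move=> /= tx; have Sx : S (gamma t0) t.
    by split=> //; rewrite tT andbT (le_trans t0s0)// ltW.
  by have := u_ge _ _ Sx; rewrite us0 lee_fin ler_pM2l// lerD2r leNgt s0t.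
have St : S (gamma t) t by split=> //; rewrite tT andbT (le_trans t0s0)// ltW.
have ut := u_ge _ _ St.
have ut0 : (0 < u (gamma t))%E.
  apply: lt_le_trans ut; rewrite lte_fin mulr_gt0// subr_gt0.
  exact: le_lt_trans t0s0 s0t.
have bU x : boundary U x -> x = gamma t0.
  move=> [_ nU]; apply: contrapT => ne; apply: nU.
  by have /interior_id -> := oU.
have bU0 : boundary U (gamma t0).
  split; last by move=> /interior_subset; apply.
  by move=> V /(start_not_isolated haus cont escape t0T)[y Vy ne]; exists y.
have usc_on_u (Y : set X) : usc_on Y u.
  move=> x _; split; first by apply: le_lt_trans (u_le x) _; rewrite ltry.
  by move=> a /(passage_time_usc haus cont escape K0) h; exact: cvg_within h.
have Eq : ereal_sup [set maxe (u x) 0%E | x in boundary U] =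
    ereal_sup [set u x | x in closure U].
  apply: slp oU (ex_intro _ _ bU0) _ _ _.
  - split; first exact: usc_on_u.
    split; first exact: usc_on_u.
    by move=> x phi _ tst; left; right; exact: passage_time_test geo sJ escape E0 EP tst.
  - by exists (K * (T - t0)) => x _; exact: u_le.
  - by exists (gamma t) => //; exact: subset_closure.
have : (ereal_sup [set maxe (u x) 0 | x in boundary U] < ereal_sup [set u x | x in closure U])%E.
  apply: (@le_lt_trans _ _ (K * (s0 - t0))%:E).
    apply: ge_ereal_sup => _ [x /bU -> <-].
    by rewrite us0 ge_max lexx/= lee_fin mulr_ge0 ?(ltW K0)// subr_ge0.
  apply: lt_le_trans (ereal_sup_ubound _); last first.
    by exists (gamma t); [exact: subset_closure|reflexivity].
  by apply: lt_le_trans ut; rewrite lte_fin ltr_pM2l// ltrD2r.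
by rewrite Eq ltxx.
Unshelve. all: by end_near. Qed.

End Ahlfors.

(** * Maximal geodesics *)

Section MaximalGeodesics.
Context {R : realType} {n : nat} {X : topologicalType}.
Context {M : smooth_manifold R n X} (g : riemannian_metric M).
Implicit Types (i j : idx M) (gamma : R -> X) (t s : R) (J : set R).

Lemma geodesic_on_congr J gamma gamma' : open J ->
  (forall t, J t -> gamma t = gamma' t) -> geodesic_on g J gamma -> geodesic_on g J gamma'.
Proof.
move=> oJ E geo t Jt; have [ct gt] := geo t Jt.
have nearJ : \forall s \near t, J s by apply: open_nbhs_nbhs.
split.
  have : gamma s @[s --> t] --> gamma' t by rewrite -E.
  by apply: cvg_trans; apply: near_eq_cvg; apply: filterS nearJ => s /E.
by move=> j jt; apply: (geodesic_at_near oJ Jt E); apply: gt; rewrite E.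
Qed.

Lemma is_derive_opp (f : R -> R) t d :
  is_derive (- t) 1 f d -> is_derive t 1 (fun s => f (- s)) (- d).
Proof.
move=> df; have := @is_derive1_comp R f -%R t _ _ df (is_deriveNid t 1).
by rewrite mulrN1.
Qed.

(** The geodesic equation is quadratic in the velocity. *)
Lemma geodesic_on_opp J gamma : open J -> geodesic_on g J gamma ->
  geodesic_on g [set t | J (- t)] (fun t => gamma (- t)).
Proof.
move=> oJ geo t /= Jt; have [ct gt] := geo _ Jt.
have ct' : {for t, continuous (fun s => gamma (- s))}.
  by apply: (@continuous_comp _ _ _ -%R gamma) => //; exact: oppr_continuous.
split=> // i it k.
have gi s : J s -> cdom (atlas i) (gamma s) -> geodesic_at g i gamma s.
  by move=> Js is_; exact: (geo s Js).2.
have good : \forall s \near t, J (- s) /\ cdom (atlas i) (gamma (- s)).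
  have h1 : \forall s \near t, J (- s).
    have ctN : (- s : R) @[s --> t] --> - t by apply: cvgN; exact: cvg_id.
    by apply: (ctN J); apply: open_nbhs_nbhs.
  exact: filterS2 h1 (near_cdom it ct').
have dc l s : J (- s) -> cdom (atlas i) (gamma (- s)) ->
    is_derive s 1 (chart_coord i (fun s => gamma (- s)) l) (- velocity i gamma l (- s)).
  move=> Js is_; have [d _ _] := gi _ Js is_ l.
  exact: (is_derive_opp (is_derive_chart_coord d)).
have vel l s : J (- s) -> cdom (atlas i) (gamma (- s)) ->
    velocity i (fun s => gamma (- s)) l s = - velocity i gamma l (- s).
  by move=> Js is_; rewrite /velocity derive1E; have [_ ->] := dc l s Js is_.
have [_ dv e] := gi _ Jt it k.
have dv' : is_derive t 1 (velocity i (fun s => gamma (- s)) k)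
    (((velocity i gamma k)^`())%classic (- t)).
  have := is_deriveN (is_derive_opp (derivableP dv)).
  rewrite opprK -derive1E; apply: near_eq_is_derive.
  by apply: filterS good => s [Js is_]; rewrite vel.
split; [by have [] := dc k t Jt it|by case: dv'|].
rewrite [X in X + _](_ : _ = ((velocity i gamma k)^`())%classic (- t)); last first.
  by rewrite derive1E; case: dv' => _ <-.
rewrite -[RHS]e; congr (_ + _); apply: eq_bigr => a _; apply: eq_bigr => b _.
have va := vel a t Jt it; have vb := vel b t Jt it.
rewrite /velocity /chart_coord in va vb; rewrite va vb.
by rewrite -mulrA mulrNN mulrA.
Qed.

Lemma extend_right J gamma (t0 b : R) : strong_laplacian_principle g ->
  open J -> is_interval J -> J t0 -> geodesic_on g J gamma ->
  (forall t, J t -> t <= b) ->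
  exists (J' : set R) (gamma' : R -> X), [/\ open J', is_interval J', geodesic_on g J' gamma',
    (forall t, J t -> J' t /\ gamma' t = gamma t) & exists2 t, J' t & ~ J t].
Proof.
move=> slp oJ iJ Jt0 geo bJ.
have supJ : has_sup J by split; [exists t0|exists b].
pose T := sup J.
have JT t : J t -> t < T.
  move=> Jt; have /near_realP[d d0 dP] : \forall s \near t, J s by apply: open_nbhs_nbhs.
  apply: (@lt_le_trans _ _ (t + d / 2)); first by rewrite ltrDl divr_gt0.
  apply: (ub_le_sup supJ.2); apply: dP.
  by rewrite addrAC subrr add0r gtr0_norm ?divr_gt0// ltr_pdivrMr// ltr_pMr// ltr1n.
have t0T := JT _ Jt0.
have sJ t : t0 <= t < T -> J t.
  move=> /andP[t0t tT]; have tT0 : 0 < T - t by rewrite subr_gt0.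
  have [s Js] := sup_adherent tT0 supJ.
  by rewrite subKr => ts; apply: iJ Jt0 Js _ _; rewrite t0t ltW.
have [x acc] := accumulation_point slp oJ iJ geo t0T sJ.
have [gamma' [e [e0 agree geo']]] :=
  extend_at_accumulation oJ iJ geo t0T sJ JT acc.
exists (J `|` `]t0, (T + e)[), gamma'; split=> //.
- by apply: openU => //; exact: itv_open.
- move=> u v Ju Jv w /andP[uw wv].
  have [wt0|t0w] := leP w t0.
    left; case: Ju => [Ju|]; first by apply: iJ Ju Jt0 _ _; rewrite uw.
    by rewrite /= in_itv/= => /andP[t0u _]; lra.
  right; rewrite /= in_itv/= t0w/=; apply: le_lt_trans wv _.
  case: Jv => [/JT h|]; first by lra.
  by rewrite /= in_itv/= => /andP[].
- by move=> t Jt; split; [left|apply: agree; exact: JT].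
- exists T; last by move=> /JT; rewrite ltxx.
  by right; rewrite /= in_itv/= t0T ltrDl.
Qed.

(** Time reversal of [extend_right]. *)
Lemma extend_left J gamma (t0 b : R) : strong_laplacian_principle g ->
  open J -> is_interval J -> J t0 -> geodesic_on g J gamma ->
  (forall t, J t -> b <= t) ->
  exists (J' : set R) (gamma' : R -> X), [/\ open J', is_interval J', geodesic_on g J' gamma',
    (forall t, J t -> J' t /\ gamma' t = gamma t) & exists2 t, J' t & ~ J t].
Proof.
have openN (K : set R) : open K -> open [set t | K (- t)].
  by move=> oK; apply: (@open_comp _ _ -%R) => // t _; exact: oppr_continuous.
have itvN (K : set R) : is_interval K -> is_interval [set t | K (- t)].
  move=> iK u v /= Ku Kv w /andP[uw wv]; apply: iK Kv Ku _ _.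
  by rewrite !lerN2 uw wv.
move=> slp oJ iJ Jt0 geo bJ.
have [|||J' [gamma' [oJ' iJ' geo' agree [t J't nJt]]]] := @extend_right
  [set t | J (- t)] (fun t => gamma (- t)) (- t0) (- b) slp (openN _ oJ) (itvN _ iJ).
- by rewrite /= opprK.
- exact: geodesic_on_opp.
- by move=> t /= /bJ; rewrite lerNr.
exists [set t | J' (- t)], (fun t => gamma' (- t)); split.
- exact: openN.
- exact: itvN.
- exact: geodesic_on_opp.
- by move=> s Js; have := agree (- s); rewrite /= opprK => /(_ Js).
- by exists (- t); rewrite /= ?opprK.
Qed.

(** Extensions are ordered by agreement on the smaller domain. The members of a
    chain agree wherever they are both defined, so they define a geodesic on the
    union of their domains, and Zorn's lemma applies. *)
Lemma maximal_extension J gamma :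
  open J -> is_interval J -> J !=set0 -> geodesic_on g J gamma ->
  exists (J' : set R) (gamma' : R -> X),
    [/\ open J', is_interval J', geodesic_on g J' gamma',
        forall t, J t -> J' t /\ gamma' t = gamma t &
        forall (K : set R) delta, open K -> is_interval K -> geodesic_on g K delta ->
          (forall t, J' t -> K t /\ delta t = gamma' t) -> forall t, K t -> J' t].
Proof.
move=> oJ iJ [t0 Jt0] geo.
pose Q (p : set R * (R -> X)) := [/\ open p.1, is_interval p.1, geodesic_on g p.1 p.2 &
  forall t, J t -> p.1 t /\ p.2 t = gamma t].
pose le (p q : set R * (R -> X)) := forall t, p.1 t -> q.1 t /\ q.2 t = p.2 t.
have Q0 : Q (J, gamma) by split.
pose Rel (p q : {p | Q p}) := `[< le (sval p) (sval q) >].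
have [||A tot|[[J' gamma'] [oJ' iJ' geo' agree]] max] := @ZL_preorder {p | Q p} (exist _ _ Q0) Rel.
- by move=> p; apply/asboolP.
- move=> q p r /asboolP pq /asboolP qr; apply/asboolP => t /pq[qt E].
  by have [rt E'] := qr t qt; rewrite E' E.
- have [[p0 Ap0]|A0] := pselect (A !=set0); last first.
    by exists (exist _ _ Q0) => p Ap; exfalso; apply: A0; exists p.
  pose D := \bigcup_(p in A) (sval p).1.
  have /choice[delta deltaP] t : exists x, forall p, A p -> (sval p).1 t -> (sval p).2 t = x.
    have [[p Ap pt]|noD] := pselect (D t); last first.
      by exists (gamma t) => p Ap pt; exfalso; apply: noD; exists p.
    exists ((sval p).2 t) => q Aq qt.
    by case: (tot p q Ap Aq) => /asboolP pq; [have [] := pq t pt|have [_ ->] := pq t qt].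
  have QD : Q (D, delta).
    split=> /=.
    - by apply: bigcup_open => p _; case: (svalP p).
    - move=> u v [p Ap pu] [q Aq qv] w uwv.
      case: (tot p q Ap Aq) => /asboolP pq.
        exists q => //; case: (svalP q) => _ iq _ _; apply: iq qv w uwv.
        by have [] := pq u pu.
      exists p => //; case: (svalP p) => _ ip _ _; apply: ip pu _ w uwv.
      by have [] := pq v qv.
    - move=> t [p Ap pt]; have [op ip gp ap] := svalP p.
      exact: (geodesic_on_congr op (fun t h => deltaP t p Ap h) gp).
    - move=> t Jt; have [_ _ _ ap] := svalP p0; have [p0t E] := ap t Jt.
      by split; [exists p0|rewrite -(deltaP t p0)].
  exists (exist _ _ QD) => p Ap; apply/asboolP => t pt /=.
  by split; [exists p|rewrite (deltaP t p)].
exists J', gamma'; split=> // K delta oK iK gK aK t Kt.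
have QK : Q (K, delta).
  split=> //= s Js; have [J's E] := agree s Js; have [Ks E'] := aK s J's.
  by rewrite E'.
have /asboolP le' : Rel (exist _ _ QK) (exist _ (J', gamma') (And4 oJ' iJ' geo' agree)).
  by apply: max; apply/asboolP.
by have [] := le' t Kt.
Qed.

End MaximalGeodesics.

Theorem corollary1p16 (R : realType) (n : nat) (X : topologicalType)
    (M : smooth_manifold R n X) (g : riemannian_metric M) :
  strong_laplacian_principle g -> geodesically_complete g.
Proof.
move=> slp J gamma oJ iJ J0 geo.
have [J' [gamma' [oJ' iJ' geo' agree max]]] := maximal_extension oJ iJ J0 geo.
have [t0 Jt0] := J0; have [J't0 _] := agree _ Jt0.
have above b : exists2 t, J' t & b < t.
  apply: contrapT => H.
  have [|K [delta [oK iK gK aK [t Kt nJt]]]] := extend_right (b := b) slp oJ' iJ' J't0 geo'.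
    by move=> t J't; rewrite leNgt; apply/negP => bt; apply: H; exists t.
  exact: nJt (max K delta oK iK gK aK t Kt).
have below b : exists2 t, J' t & t < b.
  apply: contrapT => H.
  have [|K [delta [oK iK gK aK [t Kt nJt]]]] := extend_left (b := b) slp oJ' iJ' J't0 geo'.
    by move=> t J't; rewrite leNgt; apply/negP => bt; apply: H; exists t.
  exact: nJt (max K delta oK iK gK aK t Kt).
have J'T : J' = setT.
  apply/seteqP; split=> // t _; have [u J'u ut] := below t; have [v J'v tv] := above t.
  by apply: iJ' J'u J'v _ _; rewrite !ltW.
exists gamma'; first by rewrite -J'T; exact: geo'.
by move=> t /agree[].
Qed.
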